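(* Let $n\ge 1$ and let $c$ be a positive integer. Let $k_1\ge k_2\ge\cdots\ge k_n\ge 0$ be integers and put $k_{n+1}=0$. Let $a,b_1,\dots,b_n$ be nonnegative integers, put $a_1=a$, $a_2=\cdots=a_n=0$, and $\sigma_s=b_1+\cdots+b_s$ for $s=1,\dots,n$. For $s=1,\dots,n$ let $z^{(s)}=(z^{(s)}_1,\dots,z^{(s)}_{k_s})$ be variables and $z=(z^{(1)},\dots,z^{(n)})$. If $a+\sigma_s+s\ge sc$ for every $s=1,\dots,n$, then \[ \mathrm{CT}_{z}\prod_{s=1}^{n}\frac{\prod_{i=1}^{k_s}(1/z_i^{(s)})_{a_s}(qz_i^{(s)})_{b_s}\prod_{1\le i<j\le k_s}(z_i^{(s)}/z_j^{(s)})_c(qz_j^{(s)}/z_i^{(s)})_c}{\prod_{i=1}^{k_s}(z_i^{(s)})^{b_s+1-c}\prod_{j=1}^{k_{s+1}}\prod_{i=1}^{k_s}(q^{b_s+1-c}z_i^{(s)}/z_j^{(s+1)})_c} =(-1)^{\sum_{s=1}^nk_s(b_s+1-c)}q^{\sum_{s=1}^nk_s\binom{b_s+2-c}{2}}\prod_{s=1}^nM_{k_s}\big(a+\sigma_s+s(1-c),c-1,c\big). \]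
   Context: $q$ is an indeterminate. For an integer $m\ge 0$, $(y)_m=(y;q)_m=(1-y)(1-yq)\cdots(1-yq^{m-1})$, with $(y)_0=1$. $\mathrm{CT}_{z}$ denotes the constant term (coefficient of total exponent zero) with respect to all the listed variables. Each inverse factor $(1-d\,z_i^{(s)}/z_j^{(s+1)})^{-1}$ with $d\in\mathbb{Q}(q)$ is expanded as the geometric series $\sum_{m\ge0}(d\,z_i^{(s)}/z_j^{(s+1)})^m$. For integers $k\ge 0$ and $A,B\ge0$, $c\ge 1$, \[M_k(A,B,c)=\prod_{i=0}^{k-1}\frac{(q)_{A+B+ic}(q)_{(i+1)c}}{(q)_{A+ic}(q)_{B+ic}(q)_c}.\] For any integer $m$, $\binom{m}{2}=m(m-1)/2$. *)

(* Defs.v *)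
From HB Require Import structures.
From mathcomp Require Import all_boot all_order all_algebra.
From mathcomp Require Import classical_sets fsbigop.

Set Implicit Arguments.
Unset Strict Implicit.
Unset Printing Implicit Defensive.

Import Order.TTheory GRing.Theory Num.Theory.
Local Open Scope classical_set_scope.
Local Open Scope ring_scope.

Definition Qq : fieldType := {fraction {poly rat}}.
Definition qq : Qq := tofrac 'X.

Definition qpoch (F : fieldType) (q y : F) (m : nat) : F :=
  \prod_(l < m) (1 - y * q ^+ l).

Definition morris (F : fieldType) (q : F) (k A B c : nat) : F :=
  \prod_(i < k)
    ((qpoch q q (A + B + i * c) * qpoch q q (i.+1 * c)) /
     (qpoch q q (A + i * c) * qpoch q q (B + i * c) * qpoch q q c)).

(* m * (m - 1) is always even, so the integer division is exact. *)
Definition binomz2 (m : int) : int := (m * (m - 1) %/ 2)%Z.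

Definition expo (I : finType) := {ffun I -> int}.

(* A formal series sum_u f(u) z^u, as its family of coefficients. *)
Definition lseries (I : finType) (F : fieldType) := expo I -> F.

Definition lmonom (I : finType) (F : fieldType) (d : F) (e : expo I) :
  lseries I F := fun u => if u == e then d else 0.

Definition lone (I : finType) (F : fieldType) : lseries I F := lmonom 1 0.

(* Cauchy product.  \sum_(v \in setT) is 0 when its support is infinite; this
   never occurs for products of Laurent polynomials and of geometric series in
   ratios z^(s)_i / z^(s+1)_j, as these ratios generate a pointed cone of
   exponents. *)
Definition lmul (I : finType) (F : fieldType) (f g : lseries I F) :
  lseries I F := fun u => \sum_(v \in [set: expo I]) (f v * g (u - v)).

Definition lCT (I : finType) (F : fieldType) (f : lseries I F) : F := f 0.

(* 1 - d z^e *)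
Definition lfactor (I : finType) (F : fieldType) (d : F) (e : expo I) :
  lseries I F := fun u => lmonom 1 0 u - lmonom d e u.

(* sum_(m >= 0) (d z^e)^m; for e <> 0, at most one m contributes to each
   coefficient. *)
Definition lgeom (I : finType) (F : fieldType) (d : F) (e : expo I) :
  lseries I F := fun u => \sum_(m \in [set: nat]) lmonom (d ^+ m) (e *+ m) u.

Notation "f *s g" := (lmul f g) (at level 40, left associativity).
Notation "\lprod_ ( i < n ) f" := (\big[@lmul _ _/@lone _ _]_(i < n) f)
  (at level 36, f at level 36, i at level 50, n at level 50,
   format "\lprod_ ( i  <  n )  f").
Notation "\lprod_ ( i < n | P ) f" :=
  (\big[@lmul _ _/@lone _ _]_(i < n | P) f)
  (at level 36, f at level 36, i at level 50, n at level 50,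
   format "\lprod_ ( i  <  n  |  P )  f").

(* (d z^e; q)_m *)
Definition lqpoch (I : finType) (F : fieldType) (q d : F) (e : expo I)
  (m : nat) : lseries I F := \lprod_(l < m) lfactor (d * q ^+ l) e.

(* 1 / (d z^e; q)_m, each factor expanded in nonnegative powers of z^e *)
Definition lqpochV (I : finType) (F : fieldType) (q d : F) (e : expo I)
  (m : nat) : lseries I F := \lprod_(l < m) lgeom (d * q ^+ l) e.

(* Levels are numbered from 0: s : 'I_n stands for the level s + 1. *)
Definition zvar (n : nat) (k : 'I_n -> nat) : finType := {s : 'I_n & 'I_(k s)}.

(* The exponent vector of the variable z^(s)_i *)
Definition zexp (n : nat) (k : 'I_n -> nat) (s : 'I_n) (i : 'I_(k s)) :
  expo (zvar k) := [ffun x => (x == Tagged (fun t => 'I_(k t)) i)%:R].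
Arguments zexp {n k s} i.

Definition alevel (n : nat) (a : nat) (s : 'I_n) : nat :=
  if (s : nat) == 0%N then a else 0%N.

Definition sigma (n : nat) (b : 'I_n -> nat) (s : 'I_n) : nat :=
  (\sum_(r < n | (r <= s)%N) b r)%N.

Definition level_num (F : fieldType) (q : F) (n c a : nat)
    (k b : 'I_n -> nat) (s : 'I_n) : lseries (zvar k) F :=
  (\lprod_(i < k s) (lqpoch q 1 (- zexp i) (alevel a s)
                     *s lqpoch q q (zexp i) (b s)))
  *s (\lprod_(i < k s) \lprod_(j < k s | (i < j)%N)
        (lqpoch q 1 (zexp i - zexp j) c *s lqpoch q q (zexp j - zexp i) c)).

(* The reciprocal of the denominator of level s.  The index t ranges over the
   level following s; for the last level there is none, which amounts to the
   convention k_{n+1} = 0. *)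
Definition level_denV (F : fieldType) (q : F) (n c : nat)
    (k b : 'I_n -> nat) (s : 'I_n) : lseries (zvar k) F :=
  let e : int := (b s)%:Z + 1 - c%:Z in
  (\lprod_(i < k s) lmonom 1 (zexp i *~ (- e)))
  *s (\lprod_(t < n | (t : nat) == s.+1) \lprod_(j < k t) \lprod_(i < k s)
        lqpochV q (q ^ e) (zexp i - zexp j) c).

Definition integrand (F : fieldType) (q : F) (n c a : nat)
    (k b : 'I_n -> nat) : lseries (zvar k) F :=
  \lprod_(s < n) (level_num q c a b s *s level_denV q c b s).

(* Main.v *)
Require Import Defs.
From HB Require Import structures.
From mathcomp Require Import all_boot all_order all_fingroup all_algebra.
From mathcomp Require Import classical_sets fsbigop boolp.
From mathcomp Require Import mpoly.
From mathcomp Require Import ring lra zify.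

Set Implicit Arguments.
Unset Strict Implicit.
Unset Printing Implicit Defensive.

Import Order.TTheory GRing.Theory Num.Theory.
Local Open Scope ring_scope.

(* The levels are eliminated one after the other, starting from the first.
   Put [e = b + 1 - c] and [a' = a + e], let [P(z)] be the numerator of a level
   times [prod_i z_i^-e], and write [x_j] for the inverses of the variables of
   the next level.  The key identity is
     [CT_z P(z) / prod_(i, j) (q^e x_j z_i)_c = C_k(a) * prod_j (x_j)_a'],
   so that the next level is met with [a] replaced by [a'].  One may assume that
   there are as many [x_j] as [z_i], the other [x_j] being 0.

   For generic [x], the degree of [P] in each [z_i] being smaller than that of
   the denominator, Lagrange interpolation turns the constant term into a
   weighted sum of the values of [P] where each [z_i] is a pole
   [1 / (q^(e + l) x_j)], [l < c].  The factors [(z_i/z_j)_c (q z_j/z_i)_c]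
   vanish if two variables use the same [x_j], and the factors
   [(1/z_i)_a (q z_i)_b] vanish at all poles attached to [x_j] if
   [x_j = q^-u] with [u < a'].  Along the line [s * x] the constant term is a
   polynomial in [s] of degree at most [k * a'], so these zeros determine it up
   to the constant [C_k(a)].

   If [x_0 = q^-a'], a single pole attached to [x_0] survives, namely [z = q^a],
   and the remaining sum is the one for [k - 1] variables and [a + c]; this
   gives a recursion from which [C_k(a)] follows. *)

(** * Complete homogeneous symmetric functions and Lagrange weights *)

(* The coefficient of [z ^ n] in [prod_(x <- s) 1 / (1 - x z)]. *)
Fixpoint chom (R : comNzRingType) (s : seq R) (n : nat) : R :=
  if s is x :: s' then \sum_(i < n.+1) x ^+ i * chom s' (n - i)
  else (n == 0)%:R.

(* Total version: 0 at negative degrees. *)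
Definition chomz (R : comNzRingType) (s : seq R) (m : int) : R :=
  if m is Posz n then chom s n else 0.

Section Chom.
Variable R : comNzRingType.
Implicit Types (s : seq R) (m : int).

Lemma chom_neg s m : m < 0 -> chomz s m = 0.
Proof. by case: m. Qed.

Lemma chom0 s : chom s 0 = 1.
Proof. by elim: s => //= x s IH; rewrite big_ord1 subn0 IH mul1r. Qed.

(** Multiplying the generating series by [1 - x z] removes the factor of the node [x]. *)
Lemma chomz_cons x s m : chomz (x :: s) m = chomz s m + x * chomz (x :: s) (m - 1).
Proof.
case: m => [[|n]|n].
- by rewrite sub0r [chomz _ (- _)]chom_neg // mulr0 addr0 /chomz !chom0.
- have -> : n.+1%:Z - 1 = n by lia.
  rewrite /chomz [chom (x :: s) n.+1]/= big_ord_recl subn0 expr0 mul1r; congr (_ + _).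
  rewrite [in RHS]/= mulr_sumr; apply: eq_bigr => i _.
  by rewrite lift0 exprS mulrA subSS.
- by rewrite !chom_neg // ?mulr0 ?addr0 //; lia.
Qed.

Lemma chomz_nil m : chomz ([::] : seq R) m = (m == 0)%:R.
Proof. by case: m => [[|n]|n]. Qed.

Lemma chomz_scale t s m : chomz [seq t * x | x <- s] m = t ^+ `|m|%N * chomz s m.
Proof.
case: m => [n|n]; last by rewrite /= mulr0.
rewrite /chomz absz_nat.
elim: s n => [|x s IH] n /=; first by case: n => [|n]; rewrite ?mul1r ?mulr0.
rewrite mulr_sumr; apply: eq_bigr => i _.
have -> : t ^+ n = t ^+ i * t ^+ (n - i) by rewrite -exprD subnKC // -ltnS.
rewrite IH exprMn; ring.
Qed.

Lemma chomz_cat0 s (r : seq R) m : all (fun x => x == 0) r ->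
  chomz (s ++ r) m = chomz s m.
Proof.
move=> r0; case: m => [n|n] //=.
elim: s n => [|x s IH] n /=; last by apply: eq_bigr => i _; rewrite IH.
elim: r r0 n => [|x r IH] //= /andP[/eqP-> r0] n.
rewrite big_ord_recl subn0 expr0 mul1r IH // big1 ?addr0 // => i _.
by rewrite lift0 exprS mul0r mul0r.
Qed.

End Chom.

Lemma chomz_rmorph (R S : comNzRingType) (f : {rmorphism R -> S}) (s : seq R) m :
  chomz (map f s) m = f (chomz s m).
Proof.
case: m => [n|n] /=; last by rewrite rmorph0.
elim: s n => [|x s IH] n /=; first by rewrite rmorph_nat.
by rewrite rmorph_sum; apply: eq_bigr => i _; rewrite IH rmorphM rmorphXn.
Qed.

Section Lagrange.
Variable K : fieldType.
Implicit Types (s : seq K) (m : int).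

(** The partial fraction form of the same coefficient: for distinct nonzero nodes,
    [prod_(x <- s) 1 / (1 - x z)] is the sum of the [1 / (1 - x z)] weighted by
    [prod_(y != x) (1 - y / x)^-1]. It also makes sense for negative [m]. *)
Definition lagr s m : K := \sum_(x <- s) x ^ m / \prod_(y <- s | y != x) (1 - y / x).

Lemma perm_lagr s1 s2 m : perm_eq s1 s2 -> lagr s1 m = lagr s2 m.
Proof.
move=> p; rewrite /lagr (perm_big _ p) /=; apply: eq_bigr => x _.
by rewrite (perm_big _ p).
Qed.

(** In the difference of the two sums over [x :: s] the term at [x] cancels. At any other node, [y ^
    m - x * y ^ (m - 1) = y ^ m * (1 - x / y)] cancels the factor of [x] in the weight. *)
Lemma lagr_cons x s m : uniq (x :: s) -> 0 \notin x :: s ->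
  lagr (x :: s) m = lagr s m + x * lagr (x :: s) (m - 1).
Proof.
move=> /= /andP[xs us] n0; apply/eqP; rewrite -subr_eq; apply/eqP.
rewrite /lagr mulr_sumr -sumrB big_cons big_cons eqxx /=.
have x0 : x != 0 by apply: contraNneq n0 => <-; rewrite inE eqxx.
have eqm (y : K) : y != 0 -> y ^ m = y * y ^ (m - 1).
  by move=> y0; rewrite -[in LHS](subrKC 1 m) [LHS]expfzDr // expr1z.
rewrite eqm // mulrA subrr add0r; apply: eq_big_seq => y ys.
have y0 : y != 0 by apply: contraNneq n0 => <-; rewrite inE ys orbT.
have xy : x != y by apply: contraNneq xs => ->.
rewrite big_cons xy (eqm y) //.
have : 1 - x / y != 0.
  by rewrite subr_eq0; apply: contraNneq xy => /(congr1 (fun z => z * y));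
    rewrite mul1r divfK // => ->.
move: (\prod_(_ <- _ | _) _) => P d0; rewrite !invfM.
have -> : y * y ^ (m - 1) / P = (y * y ^ (m - 1)) * (1 - x / y) * ((1 - x / y)^-1 * P^-1).
  by rewrite mulrA mulfK.
by move: (_^-1 * P^-1) (y ^ _) => W Y; field.
Qed.

(* Removing either of two distinct nodes [x], [y] relates degrees [m] and
   [m - 1], whence [x * lagr s (m - 1) = y * lagr s (m - 1)]. *)
Lemma lagr_low s m : s != [::] -> uniq s -> 0 \notin s ->
  - (size s)%:Z < m -> m <= 0 -> lagr s m = (m == 0)%:R.
Proof.
move=> s0; have [r] : exists r, size s = r.+1 by case: s s0 => // x u _; exists (size u).
elim: r s m s0 => [|r IH] [|x s] //= m _ [ss] us n0 lm m0.
  have -> : m = 0 by lia.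
  by rewrite (size0nil ss) /lagr big_seq1 big_cons big_nil eqxx /= expr0z divr1.
case: s ss us n0 lm => // y u ss; set s := [:: x, y & u] => us n0 lm.
have s2 : perm_eq s (y :: x :: u) by have := permEl (perm_catCA [:: x] [:: y] u).
move: (us); rewrite /= inE negb_or => /and3P[/andP[xy xu] yu uu].
move: (n0); rewrite !inE !negb_or => /and3P[x0 y0 u0].
have step m' : - r.+1%:Z < m' -> m' <= 0 ->
    lagr s (m' - 1) = 0 /\ lagr s m' = (m' == 0)%:R.
  move=> l1 l2.
  have e1 := lagr_cons m' us n0.
  have := @lagr_cons y (x :: u) m'.
  rewrite -!(perm_lagr _ s2) -(perm_uniq s2) -(perm_mem s2) => /(_ us n0) e2.
  rewrite (IH (y :: u)) //= ?yu ?inE ?negb_or ?y0 // in e1; last by move: ss => /= ->.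
  rewrite (IH (x :: u)) //= ?xu ?inE ?negb_or ?x0 // in e2; last by move: ss => /= ->.
  have : (x - y) * lagr s (m' - 1) = 0.
    by apply/eqP; rewrite mulrBl subr_eq0 -(inj_eq (addrI (m' == 0)%:R)) -e1 -e2.
  move/eqP; rewrite mulf_eq0 subr_eq0 (negbTE xy) /= => /eqP h; split => //.
  by rewrite e1 h mulr0 addr0.
have [->|m1] := eqVneq m 0; first by case: (step 0).
have [h1 h2] : - r.+1%:Z < m + 1 /\ m + 1 <= 0.
  by move: lm m0 m1 ss; clear => /= lm m0 m1 [ss]; lia.
by have [+ _] := step _ h1 h2; rewrite addrK.
Qed.

(** Both sides obey the same recursion on adding a node, so a double induction on the degree and the
    number of nodes reduces to [m <= 0], where [lagr_low] applies. The bound says that [z ^ - m] has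
    smaller degree than the denominator. *)
Lemma chomz_lagr s m : s != [::] -> uniq s -> 0 \notin s ->
  - (size s)%:Z < m -> chomz s m = lagr s m.
Proof.
move=> s0 us n0 lm.
have base m' : - (size s)%:Z < m' -> m' <= 0 -> chomz s m' = lagr s m'.
  move=> l1 l2; rewrite lagr_low //; have [->|h] := eqVneq m' 0; first exact: chom0.
  by rewrite chom_neg //; lia.
have [m0|m0] := leP m 0; first exact: base.
case: m lm m0 => // n _ _ {base}.
elim: n s s0 us n0 => [|n IHn] s s0 us n0.
  by rewrite lagr_low // ?oppr_lt0; [exact: chom0 | case: s s0 {us n0}].
elim: s s0 us n0 => // x s IHs _ us n0.
rewrite chomz_cons lagr_cons //.
have -> : n.+1%:Z - 1 = n by lia.
rewrite IHn //; congr (_ + _).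
have [->|s0] := eqVneq s [::]; first by rewrite chomz_nil /lagr big_nil.
apply: IHs => //; first by case/andP: us.
by move: n0; rewrite inE negb_or => /andP[].
Qed.

End Lagrange.

(** * Laurent polynomials as lists of terms *)

(** The Pochhammer symbol [qpoch] over any commutative ring, to be used for polynomials and for
    series. *)
Definition qpr (A : comNzRingType) (q y : A) (m : nat) : A :=
  \prod_(l < m) (1 - y * q ^+ l).

Lemma qpr0 (A : comNzRingType) (q y : A) m l : (l < m)%N -> 1 - y * q ^+ l = 0 ->
  qpr q y m = 0.
Proof. by move=> lm h; rewrite /qpr (bigD1 (Ordinal lm)) //= h mul0r. Qed.

Section FormalSums.
Variables (I : finType) (R : comNzRingType).
Implicit Types (l : seq (R * expo I)) (u : expo I).

(** Laurent polynomials are unreduced lists of pairs of a coefficient and an exponent vector. One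
    list can thus be evaluated in several rings, through a map [io] of coefficients and a character
    [chi] giving the monomials, and exponent bounds are checked term by term. *)
Definition lpone : seq (R * expo I) := [:: (1, 0)].
Definition lpmul l1 l2 := [seq (x.1 * y.1, x.2 + y.2) | x <- l1, y <- l2].
Definition lpfac d u : seq (R * expo I) := [:: (1, 0); (- d, u)].
Definition lpmon u : seq (R * expo I) := [:: (1, u)].
Definition lpqp q d u m := \big[lpmul/lpone]_(l < m) lpfac (d * q ^+ l) u.

Definition lpub (f : expo I -> int) (B : int) l := all (fun x => f x.2 <= B) l.

Section Bound.
Variable f : {additive expo I -> int}.

Lemma lpubW l B1 B2 : B1 <= B2 -> lpub f B1 l -> lpub f B2 l.
Proof. by move=> h /allP hl; apply/allP => x /hl /le_trans; apply. Qed.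

Lemma lpub_mon B u : f u <= B -> lpub f B (lpmon u).
Proof. by move=> h; rewrite /lpub /= h. Qed.

Lemma lpub_one : lpub f 0 lpone.
Proof. by rewrite /lpub /= raddf0 lexx. Qed.

Lemma lpub_mul l1 l2 B1 B2 : lpub f B1 l1 -> lpub f B2 l2 ->
  lpub f (B1 + B2) (lpmul l1 l2).
Proof.
move=> /allP h1 /allP h2; apply/allP => _ /allpairsP[[x y] /= [xl yl ->]] /=.
by rewrite raddfD lerD ?h1 ?h2.
Qed.

Lemma lpub_prod (J : Type) (r : seq J) (P : pred J) (B : J -> int) (F : J -> _) :
  (forall j, P j -> lpub f (B j) (F j)) ->
  lpub f (\sum_(j <- r | P j) B j) (\big[lpmul/lpone]_(j <- r | P j) F j).
Proof. by move=> h; elim/big_rec2: _ => [|j B' l Pj]; [exact: lpub_one | apply: lpub_mul; exact: h]. Qed.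

Lemma lpub_qp q d u m : lpub f (m%:Z * Num.max 0 (f u)) (lpqp q d u m).
Proof.
have -> : m%:Z * Num.max 0 (f u) = \sum_(l < m) Num.max 0 (f u).
  by rewrite sumr_const card_ord -mulr_natl natz.
by apply: lpub_prod => l _; rewrite /lpub /= raddf0 le_max lexx le_max lexx orbT.
Qed.

End Bound.

Section Eval.
Variables (A : comNzRingType) (io : {rmorphism R -> A}) (chi : expo I -> A).
Hypothesis chi0 : chi 0 = 1.
Hypothesis chiD : forall u v, chi (u + v) = chi u * chi v.

Definition lpev l := \sum_(x <- l) io x.1 * chi x.2.

Lemma lpev_one : lpev lpone = 1.
Proof. by rewrite /lpev big_seq1 rmorph1 chi0 mul1r. Qed.

Lemma lpev_mul l1 l2 : lpev (lpmul l1 l2) = lpev l1 * lpev l2.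
Proof.
rewrite /lpev big_allpairs_dep /= mulr_suml; apply: eq_bigr => x _.
rewrite mulr_sumr; apply: eq_bigr => y _.
by rewrite rmorphM chiD mulrACA.
Qed.

Lemma lpev_qp q d u m : lpev (lpqp q d u m) = qpr (io q) (io d * chi u) m.
Proof.
rewrite /lpqp (big_morph lpev lpev_mul lpev_one); apply: eq_bigr => l _.
rewrite /lpev /lpfac big_cons big_seq1 /= rmorph1 chi0 mulr1 rmorphN rmorphM rmorphXn.
by rewrite mulNr mulrAC.
Qed.

Lemma lpev_mon u : lpev (lpmon u) = chi u.
Proof. by rewrite /lpev big_seq1 rmorph1 mul1r. Qed.

End Eval.

End FormalSums.

(** * The Laurent polynomial of a level and its degrees *)

Definition evar (I : finType) (i : I) : expo I := [ffun x => (x == i)%:R].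

Lemma evarM (I : finType) (i : I) (m : int) j : (evar i *~ m) j = if j == i then m else 0.
Proof.
rewrite ffunMzE ffunE; case: eqP => _; last by rewrite mul0rz.
by rewrite -mulrzl intz mulr1.
Qed.

Section MorrisKernel.
Variables (k a b c : nat).
Let e : int := b%:Z + 1 - c%:Z.

(** The Laurent polynomial [P(z)], with the monomials [z_i ^ -e] included. *)
Definition mlist (R : comNzRingType) (q : R) : seq (R * expo 'I_k) :=
  lpmul
   (\big[@lpmul _ _/@lpone _ _]_(i < k)
     lpmul (lpmul (lpqp q 1 (- evar i) a) (lpqp q q (evar i) b)) (lpmon _ (evar i *~ (- e))))
   (\big[@lpmul _ _/@lpone _ _]_(i < k) \big[@lpmul _ _/@lpone _ _]_(j < k | (i < j)%N)
     lpmul (lpqp q 1 (evar i - evar j) c) (lpqp q q (evar j - evar i) c)).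

Definition mval (A : comNzRingType) (q : A) (chi : expo 'I_k -> A) : A :=
  (\prod_(i < k) (qpr q (chi (- evar i)) a * qpr q (q * chi (evar i)) b
                  * chi (evar i *~ (- e))))
  * \prod_(i < k) \prod_(j < k | (i < j)%N)
     (qpr q (chi (evar i - evar j)) c * qpr q (q * chi (evar j - evar i)) c).

Lemma lpev_mlist (R A : comNzRingType) (io : {rmorphism R -> A}) (q : R) chi :
  chi 0 = 1 -> (forall u v, chi (u + v) = chi u * chi v) ->
  lpev io chi (mlist q) = mval (io q) chi.
Proof.
move=> c0 cD; rewrite /mlist lpev_mul //.
have mor := big_morph (lpev io chi) (lpev_mul io cD) (lpev_one io c0).
rewrite !mor; congr (_ * _); apply: eq_bigr => i _.
  by rewrite !lpev_mul // !lpev_qp // lpev_mon rmorph1 mul1r.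
rewrite mor; apply: eq_bigr => j _.
by rewrite !lpev_mul // !lpev_qp // rmorph1 mul1r.
Qed.

Definition ecoord (I : finType) (i : I) (u : expo I) : int := u i.
Lemma ecoord_is_additive (I : finType) (i : I) : zmod_morphism (@ecoord I i).
Proof. by move=> u v; rewrite /ecoord !ffunE. Qed.
HB.instance Definition _ I i := GRing.isZmodMorphism.Build (expo I) int
  (@ecoord I i) (@ecoord_is_additive I i).

(** A term [z ^ u] calls for complete symmetric functions of degrees [- u i] in the nodes; this is
    their total degree. *)
Definition ndeg (I : finType) (u : expo I) : int := - \sum_i u i.
Lemma ndeg_is_additive (I : finType) : zmod_morphism (@ndeg I).
Proof.
move=> u v; rewrite /ndeg -opprD -sumrB; congr (- _).
by apply: eq_bigr => i _; rewrite !ffunE.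
Qed.
HB.instance Definition _ I := GRing.isZmodMorphism.Build (expo I) int
  (@ndeg I) (@ndeg_is_additive I).

(** The one-variable factors give [z_x] an exponent of at most [b - e = c - 1], and each of the
    [k - 1] pairs containing [x] at most [c]. The sum is just below the degree [k * c] of the
    denominator in [z_x], as interpolation requires. *)
Lemma mlist_coord (R : comNzRingType) (q : R) (x : 'I_k) :
  lpub (ecoord x) ((k * c)%:Z - 1) (mlist q).
Proof.
pose d (i : 'I_k) : int := (x == i)%:R.
have ce i : ecoord x (evar i) = d i by rewrite /ecoord ffunE.
have -> : (k * c)%:Z - 1 = \sum_(i < k) (c%:Z - 1) * d i
    + \sum_(i < k) \sum_(j < k | (i < j)%N) c%:Z * (d i + d j).
  rewrite (bigD1 x) //= /d eqxx mulr1 big1 ?addr0; last first.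
    by move=> i; rewrite (eq_sym i) => /negbTE->; rewrite mulr0.
  have -> : \sum_(i < k) \sum_(j < k | (i < j)%N) c%:Z * ((x == i)%:R + (x == j)%:R)
      = \sum_(j < k | j != x) c%:Z.
    under eq_bigr do (under eq_bigr do rewrite mulrDr; rewrite big_split /=).
    rewrite big_split /=.
    have -> : \sum_(i < k) \sum_(j < k | (i < j)%N) c%:Z * (x == i)%:R
        = \sum_(j < k | (x < j)%N) c%:Z.
      rewrite (bigD1 x) //= [X in _ + X]big1 ?addr0; last first.
        by move=> i; rewrite (eq_sym i) => /negbTE->; rewrite big1 // => j _; rewrite mulr0.
      by apply: eq_bigr => j _; rewrite eqxx mulr1.
    have -> : \sum_(i < k) \sum_(j < k | (i < j)%N) c%:Z * (x == j)%:R
        = \sum_(i < k | (i < x)%N) c%:Z.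
      rewrite (exchange_big_dep xpredT) //= (bigD1 x) //= [X in _ + X]big1 ?addr0; last first.
        by move=> i; rewrite (eq_sym i) => /negbTE->; rewrite big1 // => j _; rewrite mulr0.
      by apply: eq_bigr => j _; rewrite eqxx mulr1.
    rewrite [RHS](bigID (fun j : 'I_k => (x < j)%N)) /=.
    by congr (_ + _); apply: eq_bigl => j; rewrite -val_eqE /=; lia.
  by rewrite sumr_const cardC1 card_ord -mulr_natl natz; have := ltn_ord x; nia.
apply: lpub_mul.
  apply: lpub_prod => i _.
  apply: (@lpubW _ _ _ _ (a%:Z * 0 + b%:Z * d i + - e * d i)).
    by rewrite le_eqVlt; apply/orP; left; apply/eqP; rewrite /e; ring.
  apply: lpub_mul; first apply: lpub_mul.
  - apply: lpubW (lpub_qp _ _ _ _ _); rewrite raddfN /= ce /d; case: eqP; nia.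
  - apply: lpubW (lpub_qp _ _ _ _ _); rewrite /= ce /d; case: eqP; nia.
  - by apply: lpub_mon; rewrite raddfMz /= ce -mulrzl intz.
apply: lpub_prod => i _; apply: lpub_prod => j ij.
rewrite mulrDr; apply: lpub_mul; apply: lpubW (lpub_qp _ _ _ _ _); rewrite raddfB /= !ce /d.
  by case: (x == i); case: (x == j); lia.
by case: (x == i); case: (x == j); lia.
Qed.

(** Each variable contributes at most [a] from [(1/z_i)_a] and exactly [e] from [z_i ^ -e]; the pair
    factors are homogeneous of degree 0. *)
Lemma mlist_ndeg (R : comNzRingType) (q : R) :
  lpub (@ndeg _) (k%:Z * (a%:Z + e)) (mlist q).
Proof.
have ce (i : 'I_k) : ndeg (evar i) = - 1.
  rewrite /ndeg (bigD1 i) //= ffunE eqxx big1 ?addr0 // => j ji.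
  by rewrite ffunE (negbTE ji).
have -> : k%:Z * (a%:Z + e) = \sum_(i < k) (a%:Z * 1 + b%:Z * 0 + e)
    + \sum_(i < k) \sum_(j < k | (i < j)%N) 0.
  rewrite [X in _ = _ + X]big1 ?addr0; last by move=> i _; rewrite big1.
  by rewrite sumr_const card_ord -mulr_natl natz mulr1 mulr0 addr0.
apply: lpub_mul.
  apply: lpub_prod => i _.
  apply: lpub_mul; first apply: lpub_mul.
  - by apply: lpubW (lpub_qp _ _ _ _ _); rewrite raddfN /= ce; lia.
  - by apply: lpubW (lpub_qp _ _ _ _ _); rewrite /= ce; lia.
  - by apply: lpub_mon; rewrite raddfMz /= ce mulNrz mulrNz opprK intz.
apply: lpub_prod => i _; apply: lpub_prod => j ij.
rewrite -[0]addr0; apply: lpub_mul; apply: lpubW (lpub_qp _ _ _ _ _);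
  by rewrite raddfB /= !ce subrr; lia.
Qed.

End MorrisKernel.

(** * Symmetrization *)

Section Symmetrization.
Variable K : fieldType.
Implicit Types (s : seq K).

Lemma horner_prod_1subX s z : (\prod_(y <- s) (1 - y *: 'X)).[z] = \prod_(y <- s) (1 - y * z).
Proof. by rewrite horner_prod; apply: eq_bigr => y _; rewrite !hornerE. Qed.

Lemma size_prod_1subX s : (size (\prod_(y <- s) (1 - y *: 'X))%R <= (size s).+1)%N.
Proof.
elim: s => [|y r IH]; first by rewrite big_nil size_poly1.
have h1 : (size (1 - y *: 'X : {poly K})%R <= 2)%N.
  rewrite (leq_trans (size_polyD _ _)) // geq_max size_poly1 size_polyN.
  by rewrite (leq_trans (size_scale_leq _ _)) ?size_polyX.
by rewrite big_cons (leq_trans (size_polyMleq _ _)) // -subn1 leq_subLR (leq_trans (leq_add h1 IH)).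
Qed.

(* The polynomial [prod (1 - y X)] vanishes at all [1/x], and only its two
   extreme coefficients survive summation against the Lagrange weights. *)
Lemma lagr_qnum s (t : K) : s != [::] -> uniq s -> 0 \notin s ->
  \sum_(x <- s) (\prod_(y <- s) (1 - t * y / x)) / (\prod_(y <- s | y != x) (1 - y / x))
  = 1 - t ^+ size s.
Proof.
move=> s0 us n0.
pose P := \prod_(y <- s) (1 - y *: 'X).
have hP := horner_prod_1subX s : forall z, P.[z] = _.
have sP : (size P <= (size s).+1)%N := size_prod_1subX s.
have sum_t u : \sum_(x <- s) P.[u / x] / (\prod_(y <- s | y != x) (1 - y / x))
   = 1 + P`_(size s) * u ^+ size s * lagr s (- (size s)%:Z).
  have -> : 1 + P`_(size s) * u ^+ size s * lagr s (- (size s)%:Z)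
      = \sum_(m < (size s).+1) P`_m * u ^+ m * lagr s (- m%:Z).
    rewrite big_ord_recr /=; congr (_ + _).
    have [r er] : exists r, size s = r.+1 by case: (s) s0 => // x v _; exists (size v).
    rewrite er big_ord_recl big1 ?addr0 /=.
      rewrite lagr_low // ?er // -horner_coef0 hP big1 ?expr0 ?oppr0 ?eqxx ?mulr1 // => y _.
      by rewrite mulr0 subr0.
    by move=> i _; rewrite /bump leq0n add1n lagr_low // ?er ?mulr0 //; have := ltn_ord i; lia.
  rewrite /lagr; under [RHS]eq_bigr do rewrite mulr_sumr.
  rewrite exchange_big; apply: eq_bigr => x _.
  rewrite (horner_coef_wide _ sP) mulr_suml; apply: eq_bigr => m _.
  by rewrite mulrA -exprnN expr_div_n; congr (_ / _); rewrite mulrA.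
(* At [u = 1] every [P.[1 / x]] vanishes, so the top coefficient times [lagr s (- size s)] is -1. *)
have := sum_t 1; rewrite expr1n mulr1 big1_seq; last first.
  move=> x /andP[_ xs]; rewrite hP (big_rem x) //= mul1r mulfV ?subrr ?mul0r //.
  by apply: contraNneq n0 => <-.
move/esym/eqP; rewrite addrC addr_eq0 => /eqP L1.
transitivity (\sum_(x <- s) P.[t / x] / (\prod_(y <- s | y != x) (1 - y / x))).
  apply: eq_bigr => x _; rewrite hP; congr (_ / _).
  by apply: eq_bigr => y _; rewrite mulrA [y * t]mulrC.
by rewrite sum_t mulrAC L1 mulN1r.
Qed.

Definition tratio (t x y : K) := (1 - t * (y / x)) / (1 - y / x).

(** Induction on [k]: a permutation amounts to the image [i] of the first index and a permutation of
    the rest. The inner sum is the identity for the remaining values, and the sum over [i] is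
    [lagr_qnum], whose factor at [y = x] is [1 - t]. *)
Lemma sum_perm_ratio (t : K) k (z : 'I_k -> K) : 1 - t != 0 -> injective z ->
  (forall i, z i != 0) ->
  \sum_(s : 'S_k) \prod_(i < k) \prod_(j < k | (i < j)%N) tratio t (z (s i)) (z (s j))
  = \prod_(i < k) ((1 - t ^+ i.+1) / (1 - t)).
Proof.
move=> t1; elim: k z => [|k IH] z zI z0.
  rewrite big_ord0 (eq_bigr (fun=> 1)) => [|s _]; last by rewrite big_ord0.
  by rewrite sumr_const card_Sn.
pose h (p : 'I_k.+1 * 'S_k) := lift_perm ord0 p.1 p.2.
have hI : injective h.
  move=> [i s] [j r] e; have ij : i = j.
    by have := congr1 (fun f : 'S_k.+1 => f ord0) e; rewrite /h /= !lift_perm_id.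
  congr (_, _) => //; apply/permP => l.
  have := congr1 (fun f : 'S_k.+1 => f (lift ord0 l)) e.
  by rewrite /h /= !lift_perm_lift ij => /lift_inj.
have hb : bijective h.
  by apply: inj_card_bij => //; rewrite card_prod card_ord !card_Sn factS.
rewrite (reindex h) /=; last exact: onW_bij.
rewrite -(pair_bigA _ (fun i r => \prod_(i0 < k.+1) \prod_(j < k.+1 | (i0 < j)%N)
   tratio t (z (h (i, r) i0)) (z (h (i, r) j)))) /=.
under eq_bigr => i _ do under eq_bigr => r _ do
  rewrite big_ord_recl big_mkcond big_ord_recl /= mul1r.
transitivity (\sum_(i < k.+1) (\prod_(j < k) tratio t (z i) (z (lift i j)))
   * \prod_(i < k) ((1 - t ^+ i.+1) / (1 - t))).
  apply: eq_bigr => i _.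
  rewrite -(IH (z \o lift i)) => [||j]; last exact: z0; last first.
    by move=> j1 j2 /zI /lift_inj.
  rewrite mulr_sumr; apply: eq_bigr => r _; congr (_ * _).
    rewrite /h /= lift_perm_id [RHS](reindex_perm r) /=.
    by apply: eq_bigr => j _; rewrite lift_perm_lift.
  apply: eq_bigr => j _; rewrite big_mkcond big_ord_recl /= mul1r [RHS]big_mkcond /=.
  by apply: eq_bigr => j' _; rewrite !lift_perm_lift /= /bump /= !add1n ltnS.
rewrite -mulr_suml [RHS]big_ord_recr /= mulrC; congr (_ * _).
pose s := [seq z i | i <- enum 'I_k.+1].
have us : uniq s by rewrite map_inj_uniq ?enum_uniq.
have n0 : 0 \notin s by apply/mapP => -[i _ e]; have := z0 i; rewrite -e eqxx.
have ss : size s = k.+1 by rewrite size_map size_enum_ord.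
have s0 : s != [::] by rewrite -size_eq0 ss.
have := @lagr_qnum s t s0 us n0; rewrite ss => <-.
rewrite big_map big_enum mulr_suml /=; apply: eq_bigr => i _.
rewrite /s 2!big_map !big_enum_cond /= (bigD1_ord i) //=.
have -> : \prod_(j < k.+1 | z j != z i) (1 - z j / z i)
    = \prod_(j < k) (1 - z (lift i j) / z i).
  rewrite (big_mkcond (fun j => z j != z i)) (bigD1_ord i) //= eqxx mul1r.
  by apply: eq_bigr => j _; rewrite (inj_eq zI) eq_sym neq_lift.
rewrite mulfK ?z0 // mulrC mulrA mulKf //  -prodf_div.
by apply: eq_bigr => j _; rewrite /tratio mulrA.
Qed.

End Symmetrization.

(** * The constant term as a sum over a grid of nodes *)

(** A node [x] stands for the factor [1 - x z], so the pole is its inverse. The nodes form [k]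
    groups of [c], one for each [x j]. *)
Definition nodeseq (A : comNzRingType) (d q : A) (x : nat -> A) (k c : nat) : seq A :=
  [seq d * q ^+ l * x j | j <- index_iota 0 k, l <- index_iota 0 c].

(* The constant term of [L(z) * prod_i prod_(x <- s) 1 / (1 - x z_i)]. *)
Definition fsum (I : finType) (R A : comNzRingType) (io : R -> A)
    (L : seq (R * expo I)) (s : seq A) : A :=
  \sum_(x <- L) io x.1 * \prod_i chomz s (- x.2 i).

(** This makes all the nodes nonzero and distinct, and it is preserved by scaling. *)
Definition generic (K : fieldType) (q : K) (k : nat) (x : nat -> K) :=
  (forall j, (j < k)%N -> x j != 0) /\
  (forall i j n m, (i < k)%N -> (j < k)%N -> x i * q ^+ n = x j * q ^+ m -> i = j).

Section Grid.
Variables (K : fieldType) (q : K).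
Hypothesis q0 : q != 0.
Hypothesis qI : forall n m, q ^+ n = q ^+ m -> n = m.
Variables (c : nat) (e : int).
Hypothesis c0 : (0 < c)%N.

Definition node (x : nat -> K) (j l : nat) : K := q ^ e * q ^+ l * x j.

(** The denominator of the Lagrange weight, split into the nodes of the same group and those of the
    other groups. *)
Definition node_wt k (x : nat -> K) (j : 'I_k) (l : 'I_c) : K :=
  \prod_(l' < c | l' != l) (1 - node x j l' / node x j l)
  * \prod_(j' < k | j' != j) \prod_(l' < c) (1 - node x j' l' / node x j l).

Lemma node_neq0 k x j l : generic q k x -> (j < k)%N -> node x j l != 0.
Proof. by move=> [h _] /h xj; rewrite /node !mulf_neq0 ?expfz_neq0 ?expf_neq0. Qed.

Lemma node_inj k x j l j' l' : generic q k x -> (j < k)%N -> (j' < k)%N ->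
  node x j l = node x j' l' -> j = j' /\ l = l'.
Proof.
move=> [h1 h2] jk j'k; rewrite /node -!mulrA => /(mulfI (expfz_neq0 _ q0)) h.
have jj : j = j' by apply: (h2 _ _ l l') => //; rewrite mulrC h mulrC.
by split=> //; apply: qI; move: h; rewrite jj => /(mulIf (h1 _ j'k)).
Qed.

Lemma nodeseq_uniq k x : generic q k x -> uniq (nodeseq (q ^ e) q x k c).
Proof.
move=> g; apply: allpairs_uniq; rewrite ?iota_uniq //.
move=> _ _ /allpairsP[[j l] /= [+ _ ->]] /allpairsP[[j' l'] /= [+ _ ->]] /=.
by rewrite !mem_index_iota => jk jk' /(node_inj g jk jk')[-> ->].
Qed.

Lemma nodeseq_neq0 k x : generic q k x -> 0 \notin nodeseq (q ^ e) q x k c.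
Proof.
move=> g; apply/allpairsP => -[[j l] /= [+ _ /esym/eqP]].
by rewrite mem_index_iota => jk; apply/negP; exact: (node_neq0 l g jk).
Qed.

Lemma size_nodeseq k x : size (nodeseq (q ^ e) q x k c) = (k * c)%N.
Proof. by rewrite size_allpairs !size_iota !subn0. Qed.

Lemma lagr_nodeseq k x m : generic q k x ->
  lagr (nodeseq (q ^ e) q x k c) m
  = \sum_(j < k) \sum_(l < c) node x j l ^ m / node_wt x j l.
Proof.
move=> g; rewrite /lagr big_allpairs_dep /= big_mkord; apply: eq_bigr => j _.
rewrite big_mkord; apply: eq_bigr => l _; congr (_ / _).
rewrite big_mkcond big_allpairs_dep /= big_mkord (bigD1 j) //= big_mkord.
congr (_ * _).
  rewrite [RHS]big_mkcond /=; apply: eq_bigr => l' _; congr (if _ then _ else _).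
  congr (~~ _); apply/eqP/eqP => [|-> //].
  by move/(node_inj g (ltn_ord j) (ltn_ord j)) => [_ /val_inj].
apply: eq_bigr => j' jj; rewrite big_mkord; apply: eq_bigr => l' _.
rewrite ifT //; apply: contraNneq jj => /(node_inj g (ltn_ord j') (ltn_ord j))[h _].
by apply/eqP/val_inj.
Qed.

Definition chiz k (z : 'I_k -> K) (u : expo 'I_k) : K := \prod_i z i ^ u i.

Lemma chiz0 k (z : 'I_k -> K) : chiz z 0 = 1.
Proof. by rewrite /chiz big1 // => i _; rewrite ffunE expr0z. Qed.

Lemma chizD k (z : 'I_k -> K) : (forall i, z i != 0) ->
  forall u v, chiz z (u + v) = chiz z u * chiz z v.
Proof.
by move=> z0 u v; rewrite /chiz -big_split; apply: eq_bigr => i _; rewrite ffunE expfzDr.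
Qed.

(** The degree bound turns each [chomz] into a sum over the nodes. Distributing the product gives a
    sum over the choices of a node for each variable: [f] is its group and [g] its place in the
    group. *)
Lemma fsum_grid (R : comNzRingType) (io : {rmorphism R -> K}) k x
    (L : seq (R * expo 'I_k)) : generic q k x ->
  (forall i, lpub (ecoord i) ((k * c)%:Z - 1) L) ->
  fsum io L (nodeseq (q ^ e) q x k c)
  = \sum_(f : {ffun 'I_k -> 'I_k}) \sum_(g : {ffun 'I_k -> 'I_c})
      (\prod_i (node_wt x (f i) (g i))^-1)
      * lpev io (chiz (fun i => (node x (f i) (g i))^-1)) L.
Proof.
move=> g hL; rewrite /fsum /lpev.
under [RHS]eq_bigr do under eq_bigr do rewrite mulr_sumr.
under [RHS]eq_bigr do rewrite exchange_big /=.
rewrite exchange_big /=; apply: eq_big_seq => y yL.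
transitivity (io y.1 * \prod_(i < k) \sum_(j < k) \sum_(l < c)
    node x j l ^ (- y.2 i) / node_wt x j l).
  congr (_ * _); apply: eq_bigr => i _.
  rewrite chomz_lagr ?lagr_nodeseq ?nodeseq_uniq ?nodeseq_neq0 ?size_nodeseq //.
    by rewrite -size_eq0 size_nodeseq muln_eq0 negb_or -!lt0n c0 andbT (leq_ltn_trans _ (ltn_ord i)).
  move/allP: (hL i) => /(_ _ yL). by rewrite /= /ecoord => h; rewrite ltrN2 -lezD1 -lerBrDr.
rewrite bigA_distr_bigA mulr_sumr; apply: eq_bigr => f _.
rewrite bigA_distr_bigA mulr_sumr; apply: eq_bigr => h _.
rewrite mulrCA; congr (_ * _); rewrite /chiz -big_split; apply: eq_bigr => i _ /=.
by rewrite mulrC exprz_inv.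
Qed.

End Grid.

(** * Reduction to one pole from each group *)

Lemma prod_pairs (A : comNzRingType) k (g : 'I_k -> 'I_k -> A) :
  \prod_(i < k) \prod_(j < k | (i < j)%N) (g i j * g j i)
  = \prod_(i < k) \prod_(j < k | j != i) g i j.
Proof.
under eq_bigr do rewrite big_split /=.
rewrite big_split /= [X in _ * X](exchange_big_dep xpredT) //= -big_split.
apply: eq_bigr => i _ /=; rewrite [RHS](bigID (fun j : 'I_k => (i < j)%N)) /=.
by congr (_ * _); apply: eq_bigl => j; rewrite -val_eqE /=; lia.
Qed.

Lemma prod_pairs_perm (A : comNzRingType) k (g : 'I_k -> 'I_k -> A) (s : 'S_k) :
  \prod_(i < k) \prod_(j < k | j != i) g (s i) (s j)
  = \prod_(i < k) \prod_(j < k | j != i) g i j.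
Proof.
rewrite [RHS](reindex_perm s) /=; apply: eq_bigr => i _.
by rewrite [RHS](reindex_perm s) /=; apply: eq_bigl => j; rewrite (inj_eq perm_inj).
Qed.

Section Kernel.
Variables (K : fieldType) (q : K).
Hypothesis q0 : q != 0.
Hypothesis qI : forall n m, q ^+ n = q ^+ m -> n = m.
Variables (b c : nat).
Hypothesis c0 : (0 < c)%N.
Let e : int := b%:Z + 1 - c%:Z.
Let t := q ^+ c.

Definition edge_val (a : nat) (z : K) : K := qpr q z^-1 a * qpr q (q * z) b * z ^ (- e).

Lemma chiz_evar k (z : 'I_k -> K) i (m : int) : chiz z (evar i *~ m) = z i ^ m.
Proof.
rewrite /chiz (bigD1 i) //= evarM eqxx big1 ?mulr1 // => j ji.
by rewrite evarM (negbTE ji) expr0z.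
Qed.

Lemma mval_chiz a k (z : 'I_k -> K) : (forall i, z i != 0) ->
  mval a b c q (chiz z) = \prod_i edge_val a (z i)
   * \prod_(i < k) \prod_(j < k | (i < j)%N)
      (qpr q (z i / z j) c * qpr q (q * (z j / z i)) c).
Proof.
move=> z0; have ce i : chiz z (evar i) = z i by rewrite -[evar i]mulr1z chiz_evar expr1z.
have cN i : chiz z (- evar i) = (z i)^-1 by rewrite -[evar i]mulr1z -mulrNz chiz_evar.
rewrite /mval; congr (_ * _); apply: eq_bigr => i _.
  by rewrite cN ce chiz_evar.
by apply: eq_bigr => j _; rewrite !chizD // !cN !ce.
Qed.

(** The two symbols share all but one factor each. With [y = z_j / z_i] this makes a pair factor
    symmetric up to a [tratio]. *)
Lemma qpr_shift y : 1 - y != 0 -> qpr q (q * y) c = qpr q y c * ((1 - t * y) / (1 - y)).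
Proof.
move=> y1; apply: (mulIf y1); rewrite -mulrA divfK // /qpr.
transitivity (\prod_(l < c.+1) (1 - y * q ^+ l)); last by rewrite big_ord_recr /= /t [q ^+ c * y]mulrC.
rewrite big_ord_recl expr0 mulr1 mulrC; congr (_ * _); apply: eq_bigr => i _.
by rewrite lift0 exprS mulrA [y * q]mulrC.
Qed.

(** The sum in which variable [i] sits at a pole of group [i], each pair factor being replaced by
    its symmetric part. *)
Definition symsum (a k : nat) (x : nat -> K) : K :=
  \sum_(g : {ffun 'I_k -> 'I_c})
    (\prod_i ((node_wt q e x i (g i))^-1 * edge_val a (node q e x i (g i))^-1))
    * \prod_(i < k) \prod_(j < k | j != i)
        qpr q (node q e x j (g j) / node q e x i (g i)) c.

(* If two variables sit at nodes of the same group, their tratio is a power of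
   [q] killed by one of the two Pochhammer factors of the pair. *)
Lemma pair_vanish x (j l1 l2 : nat) (z := fun l => (node q e x j l)^-1) :
  x j != 0 -> (l1 < c)%N -> (l2 < c)%N ->
  qpr q (z l1 / z l2) c * qpr q (q * (z l2 / z l1)) c = 0.
Proof.
move=> xj l1c l2c.
have n0 l : node q e x j l != 0 by rewrite /node !mulf_neq0 ?expfz_neq0 ?expf_neq0.
have E (l l' : nat) : z l / z l' * q ^+ l = q ^+ l'.
  have cancel (A B C X : K) : A != 0 -> B != 0 -> X != 0 ->
      (A * B * X)^-1 * (A * C * X) * B = C.
    by move=> A0 B0 X0; field; rewrite A0 B0 X0.
  by rewrite /z /node invrK cancel ?expfz_neq0 ?expf_neq0.
have [le|lt] := leqP l2 l1.
  rewrite [X in X * _](@qpr0 _ _ _ _ (l1 - l2)) ?mul0r ?(leq_ltn_trans (leq_subr _ _)) //.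
  apply/eqP; rewrite subr_eq0 eq_sym; apply/eqP.
  apply: (mulIf (expf_neq0 l2 q0)); rewrite -mulrA -exprD subnK // E mul1r.
  done.
rewrite [X in _ * X](@qpr0 _ _ _ _ (l2 - l1.+1)) ?mulr0 //; first lia.
apply/eqP; rewrite subr_eq0 eq_sym; apply/eqP.
apply: (mulIf (expf_neq0 l1 q0)); rewrite mul1r -[RHS](E l2 l1).
have -> : q ^+ l2 = q ^+ (l2 - l1.+1) * (q * q ^+ l1) by rewrite -exprS -exprD subnK.
by ring.
Qed.

(** Choices putting two variables in one group vanish by [pair_vanish], so the groups are assigned
    by a permutation. It affects only the [tratio] factors, which [sum_perm_ratio] sums. *)
Lemma fsum_symsum (R : comNzRingType) (io : {rmorphism R -> K}) (p : R) a k x :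
  io p = q -> generic q k x ->
  fsum io (mlist k a b c p) (nodeseq (q ^ e) q x k c)
  = \prod_(i < k) ((1 - t ^+ i.+1) / (1 - t)) * symsum a k x.
Proof.
move=> iop g; have t1 : 1 - t != 0.
  by rewrite subr_eq0 -(expr0 q); apply/eqP => /qI h; have := c0; rewrite -h.
rewrite fsum_grid //; last exact: mlist_coord.
have n0 (f : {ffun 'I_k -> 'I_k}) (h : {ffun 'I_k -> 'I_c}) (i : 'I_k) :
  (node q e x (f i) (h i))^-1 != 0.
  by rewrite invr_eq0 (node_neq0 q0 _ _ g).
under eq_bigr => f _ do under eq_bigr => h _ do
  rewrite (lpev_mlist a b c io p (chiz0 _) (chizD (n0 f h))) iop mval_chiz //.
rewrite (bigID (fun f : {ffun 'I_k -> 'I_k} => injectiveb f)) /= addrC big1 ?add0r; last first.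
  move=> f /injectivePn[i [j ij fij]]; apply: big1 => h _.
  wlog lt_ij : i j ij fij / (i < j)%N.
    move=> W; case: (ltngtP i j) => [lt|lt|/val_inj eq]; first exact: W lt.
      by apply: (W j i) => //; rewrite eq_sym.
    by rewrite eq eqxx in ij.
  rewrite [X in _ * (_ * X)](bigD1 i) //= [X in _ * (_ * (X * _))](bigD1 j) //= fij.
  by rewrite pair_vanish ?mul0r ?mulr0 //; case: g => g _; apply: g.
rewrite (reindex (@pval _)) /=; last first.
  pose ins := insubd (1%g : 'S_k); exists ins => [s _ | f]; first exact: valKd.
  by rewrite inE => h; exact: insubdK.
transitivity (\sum_(s : 'S_k) \sum_(g : {ffun 'I_k -> 'I_c})
    ((\prod_i ((node_wt q e x i (g i))^-1 * edge_val a (node q e x i (g i))^-1))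
    * \prod_(i < k) \prod_(j < k | j != i)
        qpr q (node q e x j (g j) / node q e x i (g i)) c)
    * \prod_(i < k) \prod_(j < k | (i < j)%N)
        tratio t (node q e x (s i) (g (s i)))^-1 (node q e x (s j) (g (s j)))^-1).
  rewrite (eq_bigl xpredT); last by move=> s; exact: (valP s).
  apply: eq_bigr => s _.
  (* The places are reindexed by group instead of by variable. *)
  have sI : injective (fun g : {ffun 'I_k -> 'I_c} => [ffun i => g (s i)]).
    move=> g1 g2 /ffunP h; apply/ffunP => i; have := h ((s^-1)%g i).
    by rewrite !ffunE permKV.
  rewrite (reindex_inj sI) /=; apply: eq_bigr => h _.
  rewrite mulrA -big_split /= -mulrA; congr (_ * _).
    by rewrite [RHS](reindex_perm s) /=; apply: eq_bigr => i _; rewrite pvalE ffunE.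
  rewrite -(prod_pairs_perm (fun i j => qpr q (node q e x j (h j) / node q e x i (h i)) c) s).
  rewrite -prod_pairs -big_split; apply: eq_bigr => i _.
  rewrite -big_split; apply: eq_bigr => j ij /=.
  rewrite !pvalE !ffunE !invrK ![(node _ _ _ _ _)^-1 * _]mulrC qpr_shift.
    by rewrite /tratio !invrK ![(node _ _ _ _ _)^-1 * _]mulrC mulrA.
  rewrite subr_eq0 eq_sym; apply/eqP => /divr1_eq /(node_inj q0 qI g (ltn_ord _) (ltn_ord _))[].
  by move/val_inj/perm_inj => eij; rewrite eij ltnn in ij.
rewrite exchange_big mulr_sumr; apply: eq_bigr => h _ /=.
rewrite -mulr_sumr mulrC; congr (_ * _).
apply: (@sum_perm_ratio _ t k (fun i => (node q e x i (h i))^-1)) => // [i j|i].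
  by move=> /invr_inj /(node_inj q0 qI g (ltn_ord i) (ltn_ord j))[/val_inj].
by rewrite invr_eq0 (node_neq0 q0 _ _ g).
Qed.

End Kernel.

(** * Zeros and degree in the denominators *)

Section Factor.
Variables (K : fieldType) (q : K).
Hypothesis q0 : q != 0.
Hypothesis qI : forall n m, q ^+ n = q ^+ m -> n = m.
Variables (b c : nat).
Hypothesis c0 : (0 < c)%N.
Let e : int := b%:Z + 1 - c%:Z.
Let t := q ^+ c.

(** At [q ^ m] the factor [(1/z)_a] vanishes if [0 <= m < a], and [(q z)_b] if [- b <= m < 0]. *)
Lemma edge_val_vanish a (m : int) : - b%:Z <= m < a%:Z -> edge_val q b c a (q ^ m) = 0.
Proof.
rewrite /edge_val; case: m => m /andP[h1 h2].
  by rewrite (@qpr0 _ _ _ _ m) ?mul0r // mulVf ?subrr // expf_neq0.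
rewrite [X in _ * X * _](@qpr0 _ _ _ _ m) ?mulr0 ?mul0r //; first lia.
by rewrite NegzE -exprnN exprS invfM mulrA mulfV // mul1r mulVf ?subrr // expf_neq0.
Qed.

Lemma nodeV_qz x j u l : x j * q ^+ u = 1 ->
  (node q e x j l)^-1 = q ^ (u%:Z - e - l%:Z).
Proof.
move=> xu; have xj : x j = q ^- u by apply: (mulIf (expf_neq0 u q0)); rewrite xu mulVf ?expf_neq0.
rewrite /node xj exprnN exprnP -!expfzDr // invr_expz; congr (_ ^ _); lia.
Qed.

(** The poles of group [j] are [q ^ (u - e - l)] with [l < c]. These exponents run from [u - b] to
    [u - e], and [u < a'] means [u - e < a], so [edge_val] vanishes at all of them. *)
Lemma symsum_vanish a a' k (x : nat -> K) (j : 'I_k) u : a'%:Z = a%:Z + e -> (u < a')%N ->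
  x j * q ^+ u = 1 -> symsum q b c a k x = 0.
Proof.
move=> ha ua xu; rewrite /symsum big1 // => g _.
rewrite (bigD1 j) //= (nodeV_qz _ xu) edge_val_vanish ?mulr0 ?mul0r //.
by move: (nat_of_ord (g j)) (ltn_ord (g j)) => l lc; rewrite /e in ha *; apply/andP; split; lia.
Qed.

Lemma generic_scale k x s : s != 0 -> generic q k x -> generic q k (fun j => s * x j).
Proof.
move=> s0 [h1 h2]; split=> [j /h1 xj|i j n m ik jk]; first by rewrite mulf_neq0.
by rewrite -!mulrA => /(mulfI s0); exact: h2.
Qed.

Lemma nodeseq_scale k x s d : nodeseq d q (fun j => s * x j) k c = [seq s * y | y <- nodeseq d q x k c].
Proof.
by rewrite /nodeseq map_allpairs; apply: eq_allpairs => j l; rewrite mulrCA.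
Qed.

(* Along the line [s * x] the sum is a polynomial in [s] of degree at most
   [k * a'], and every [s = (x j * q ^+ u)^-1] with [u < a'] is a root. *)
Lemma fsum_factor (R : comNzRingType) (io : {rmorphism R -> K}) (p : R) a a' k x :
  io p = q -> a'%:Z = a%:Z + e -> generic q k x ->
  fsum io (mlist k a b c p) (nodeseq (q ^ e) q x k c)
  = fsum io (mlist k a b c p) [::] * \prod_(j < k) qpr q (x j) a'.
Proof.
move=> iop ha g; set L := mlist _ _ _ _ _.
pose s0 := nodeseq (q ^ e) q x k c.
(* [P.[s]] is the sum at the nodes scaled by [s]. The absolute value is harmless: a term with a
   positive exponent has coefficient 0, and for the others [ndeg] is nonnegative. *)
pose P := \sum_(y <- L) (io y.1 * \prod_i chomz s0 (- y.2 i)) *: 'X^`|ndeg y.2|%N.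
have posz (y : expo 'I_k) : (exists i, 0 < y i)
    \/ (ndeg y = (\sum_i `|- y i|)%N%:Z /\ forall i, y i <= 0).
  case: (boolP [exists i, 0 < y i]) => [/existsP|/existsPn h]; [by left | right].
  split=> [|i]; last by rewrite leNgt h.
  rewrite /ndeg -sumrN (big_morph Posz PoszD (erefl _)).
  by apply: eq_bigr => i _; move: (h i); lia.
have coef0 (y : expo 'I_k) i : 0 < y i -> \prod_(i < k) chomz s0 (- y i) = 0.
  by move=> yi; rewrite (bigD1 i) //= chom_neg ?mul0r // oppr_lt0.
have hP s : P.[s] = fsum io L [seq s * y | y <- s0].
  rewrite /P /fsum horner_sum; apply: eq_bigr => y _.
  rewrite hornerZ hornerXn; under [in RHS]eq_bigr do rewrite chomz_scale.
  have [[i yi]|[-> _]] := posz y.2.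
    by rewrite big_split /= !(coef0 _ _ yi) !mulr0 mul0r.
  by rewrite big_split /= prodrXr mulrCA mulrC.
have sP : (size P <= (k * a').+1)%N.
  apply: (leq_trans (size_sum _ _ _)); apply/bigmax_leqP_seq => y yL _.
  have [[i yi]|[hy yneg]] := posz y.2.
    by rewrite (coef0 _ _ yi) mulr0 scale0r size_poly0.
  apply: (leq_trans (size_scale_leq _ _)); rewrite size_polyXn ltnS.
  by have /allP/(_ _ yL) := mlist_ndeg k a b c p; rewrite -/e -ha /= hy; lia.
have P0 : P.[0] = fsum io L [::].
  rewrite hP /fsum; apply: eq_bigr => y _; congr (_ * _); apply: eq_bigr => i _.
  rewrite -[RHS](@chomz_cat0 _ [::] [seq 0 * y | y <- s0]) //.
  by apply/allP => _ /mapP[z _ ->]; rewrite mul0r eqxx.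
pose ys := [seq x j * q ^+ u | j <- index_iota 0 k, u <- index_iota 0 a'].
have ys0 : 0 \notin ys.
  apply/allpairsP => -[[j u] /= [+ _ /esym/eqP]].
  rewrite mem_index_iota mulf_eq0 => jk; apply/negP; rewrite negb_or expf_neq0 // andbT.
  by case: g => g _; apply: g.
have uys : uniq ys.
  apply: allpairs_uniq; rewrite ?iota_uniq //.
  move=> _ _ /allpairsP[[j l] /= [+ _ ->]] /allpairsP[[j' l'] /= [+ _ ->]] /=.
  rewrite !mem_index_iota; case: g => h1 h2 jk jk' h.
  have jj := h2 _ _ _ _ jk jk' h; rewrite -jj in h *.
  by rewrite (qI (mulfI (h1 _ jk) h)).
pose Q := \prod_(y <- ys) (1 - y *: 'X).
have hQ s : Q.[s] = \prod_(j < k) qpr q (s * x j) a'.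
  rewrite horner_prod_1subX big_allpairs_dep big_mkord; apply: eq_bigr => j _.
  by rewrite big_mkord; apply: eq_bigr => u _; rewrite mulrC mulrA.
have sys : size ys = (k * a')%N by rewrite size_allpairs !size_iota !subn0.
have : P - fsum io L [::] *: Q = 0.
  (* The roots are the [k * a'] inverses of [ys] together with 0, where [Q] is 1: one more than the
     degree allows. *)
  apply: (@roots_geq_poly_eq0 _ _ (0 :: [seq y^-1 | y <- ys])).
  - rewrite /= /root hornerD hornerN hornerZ P0 horner_prod_1subX big1 ?mulr1 ?subrr ?eqxx; last first.
      by move=> y _; rewrite mulr0 subr0.
    apply/allP => _ /mapP[y yys ->]; have y0 : y != 0 by apply: contraNneq ys0 => <-.
    rewrite hornerD hornerN hornerZ horner_prod_1subX (big_rem y) //= mulfV // subrr mul0r mulr0 subr0.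
    case/allpairsP: yys => -[j u] /= [jk uk ey]; rewrite !mem_index_iota /= in jk uk.
    rewrite hP /s0 -nodeseq_scale (fsum_symsum q0 qI _ c0 _ iop); last first.
      by apply: generic_scale => //; rewrite invr_eq0.
    rewrite (@symsum_vanish _ a' _ _ (Ordinal jk) u) ?mulr0 //=.
    by rewrite -mulrA -ey mulVf.
  - rewrite /= map_inj_uniq ?uys ?andbT; last exact: invr_inj.
    by apply/mapP => -[y yys /esym/eqP]; rewrite invr_eq0 => /eqP y0; rewrite y0 (negbTE ys0) in yys.
  - rewrite /= size_map sys (leq_trans (size_polyD _ _)) // geq_max sP size_polyN.
    by rewrite (leq_trans (size_scale_leq _ _)) // (leq_trans (size_prod_1subX _)) // sys.
move/eqP; rewrite subr_eq0 => /eqP /(congr1 (fun f => f.[1])).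
rewrite hP hornerZ hQ (eq_map (fun y => mul1r y)) map_id => ->; congr (_ * _).
by apply: eq_bigr => j _; rewrite mul1r.
Qed.
End Factor.

(** * Recursion in the number of variables *)

Lemma qprD (A : comNzRingType) (q y : A) m n :
  qpr q y (m + n) = qpr q y m * qpr q (y * q ^+ m) n.
Proof.
rewrite /qpr big_split_ord /=; congr (_ * _); apply: eq_bigr => i _.
by rewrite exprD mulrA.
Qed.

Lemma prod_pairs_recl (A : comNzRingType) k (g : 'I_k.+1 -> 'I_k.+1 -> A) :
  \prod_(i < k.+1) \prod_(j < k.+1 | j != i) g i j
  = \prod_(i < k) (g ord0 (lift ord0 i) * g (lift ord0 i) ord0)
    * \prod_(i < k) \prod_(j < k | j != i) g (lift ord0 i) (lift ord0 j).
Proof.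
rewrite big_ord_recl [X in X * _]big_mkcond [X in X * _]big_ord_recl eqxx /= mul1r.
rewrite big_split /= -mulrA; congr (_ * _); rewrite -big_split; apply: eq_bigr => i _ /=.
rewrite big_mkcond big_ord_recl /= [in RHS]big_mkcond; congr (_ * _).
Qed.

Section Recursion.
Variables (K : fieldType) (q : K).
Hypothesis q0 : q != 0.
Hypothesis qI : forall n m, q ^+ n = q ^+ m -> n = m.
Variables (b c : nat).
Hypothesis c0 : (0 < c)%N.
Let e : int := b%:Z + 1 - c%:Z.
Let t := q ^+ c.
Let o0 : 'I_c := Ordinal c0.

(** The poles of group 0 are [q ^ (a - l)], and only [l = 0] escapes the zeros of [edge_val]. The
    value and the weight there give the prefactor, and the pair factors with the other variables
    raise [a] to [a + c]. *)
Lemma symsum_rec a a' k (x : nat -> K) : a'%:Z = a%:Z + e -> generic q k.+1 x ->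
  x 0%N * q ^+ a' = 1 ->
  symsum q b c a k.+1 x
  = edge_val q b c a (q ^+ a) / qpr q q c.-1
    * (\prod_(j < k) (qpr q (q ^+ a' * x j.+1) c)^-1)
    * symsum q b c (a + c) k (x \o succn).
Proof.
move=> ha g x0.
(* [ext] completes a choice of places in the other groups by place 0 in group 0. *)
pose ext (h : {ffun 'I_k -> 'I_c}) : {ffun 'I_k.+1 -> 'I_c} :=
  [ffun i => if unlift ord0 i is Some j then h j else o0].
have ext0 h : ext h ord0 = o0 by rewrite ffunE unlift_none.
have extS h j : ext h (lift ord0 j) = h j by rewrite ffunE liftK.
have n00 : node q e x 0 0 = q ^- a.
  have := nodeV_qz q0 b c0 0 x0; rewrite -/e => /(congr1 GRing.inv); rewrite invrK => ->.
  by rewrite exprnN invr_expz; congr (_ ^ _); lia.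
have nn0 j l : (j < k.+1)%N -> node q e x j l != 0 by move=> jk; exact: (node_neq0 q0 e l g jk).
rewrite /symsum (bigID (fun h : {ffun 'I_k.+1 -> 'I_c} => h ord0 == o0)) /=.
rewrite [X in _ + X]big1 ?addr0; last first.
  move=> h h0; rewrite (bigD1 ord0) //= (nodeV_qz q0 b c0 _ x0) edge_val_vanish ?mulr0 ?mul0r //.
  have : (h ord0 : nat) <> 0%N by move=> h1; case/eqP: h0; apply/val_inj.
  move: (nat_of_ord (h ord0)) (ltn_ord (h ord0)) => l lc l0.
  by rewrite /e in ha *; apply/andP; split; lia.
rewrite (reindex_onto ext (fun h => [ffun j => h (lift ord0 j)])); last first.
  move=> h /eqP h0; apply/ffunP => i; rewrite ffunE.
  by case: unliftP => [j ->|->]; rewrite ?ffunE.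
rewrite (eq_bigl xpredT); last first.
  move=> h; rewrite ext0 eqxx /=; apply/eqP/ffunP => j; by rewrite ffunE extS.
rewrite mulr_sumr; apply: eq_bigr => h _.
rewrite big_ord_recl prod_pairs_recl ext0 /=.
under [X in _ * (X * _)]eq_bigr do rewrite extS.
under [X in _ * (_ * X)]eq_bigr do under eq_bigr do rewrite !extS.
under [X in _ * X * _]eq_bigr do rewrite extS.
have n0l l : node q e x 0 l = q ^- a * q ^+ l.
  by rewrite -n00 /node expr0 mulr1 mulrAC.
have -> : node_wt q e x (ord0 : 'I_k.+1) o0
   = qpr q q c.-1 * \prod_(j < k) qpr q (q ^+ a' * x j.+1) c.
  rewrite /node_wt; congr (_ * _).
    have -> : \prod_(l' < c | l' != o0) (1 - node q e x (ord0 : 'I_k.+1) l'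
        / node q e x (ord0 : 'I_k.+1) o0) = \prod_(1 <= l' < c) (1 - q ^+ l').
      rewrite -(big_mkord (fun l => l != 0%N) (fun l => 1 - node q e x 0 l / node q e x 0 0)).
      rewrite big_ltn_cond //= big_nat_cond [RHS]big_nat_cond.
      apply: eq_big => [l|l _]; first by case: l => [|l] /=; rewrite ?andbF ?andbT.
      by rewrite !n0l expr0 mulr1 mulrC mulKf // invr_eq0 expf_neq0.
    by rewrite big_add1 big_mkord; apply: eq_bigr => l _; rewrite exprS.
  rewrite big_mkcond big_ord_recl eqxx /= mul1r; apply: eq_bigr => j _.
  apply: eq_bigr => l _; rewrite /node expr0 mulr1; congr (1 - _).
  rewrite -[x (bump 0 j)]/(x j.+1).
  have x0n : x 0%N != 0 by case: g => g _; exact: g.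
  have -> : q ^+ a' = (x 0%N)^-1 by apply: (mulfI x0n); rewrite x0 mulfV.
  have := expfz_neq0 e q0; move: (q ^ e) => Q Q0.
  by field; rewrite x0n Q0.
have -> : (node q e x 0 0)^-1 = q ^+ a by rewrite n00 invrK.
rewrite mulrA [RHS]mulrA; congr (_ * _).
rewrite -mulrA -big_split /=; congr (_ * _).
  by rewrite invfM prodfV; move: (edge_val _ _ _ _ _) => PV; rewrite [LHS]mulrC mulrA.
apply: eq_bigr => j _.
rewrite -[bump 0 j]/(j.+1).
set z := node q _ x j.+1 (h j); rewrite -[node q _ (x \o succn) j (h j)]/z.
have z0 : z != 0 by exact: (nn0 _ (h j) (ltn_ord (lift ord0 j))).
(* Group 0 contributes [(q^-a / z)_c] to the weight of the node [z]. It cancels one pair factor; the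
   other, [(z q^a)_c], extends [(z)_a] to [(z)_(a+c)]. *)
have -> : node_wt q (b%:Z + 1 - c%:Z) x (lift ord0 j) (h j) = node_wt q e (x \o succn) j (h j)
    * qpr q (q ^- a / z) c.
  rewrite /node_wt big_mkcond [X in _ * X]big_mkcond big_ord_recl /=.
  rewrite -big_mkcond mulrCA [LHS]mulrC; congr (_ * _).
    congr (_ * _); rewrite [RHS]big_mkcond; apply: eq_bigr => i _.
    by rewrite (inj_eq lift_inj).
  by apply: eq_bigr => l _; rewrite -/e n0l mulrAC.
have Xn0 : qpr q (q ^- a / z) c != 0.
  apply/prodf_neq0 => l _; rewrite subr_eq0; apply/eqP => h1.
  have h2 : node q e x 0 l = node q e x j.+1 (h j).
    by rewrite n0l -/z; apply: (mulIf (invr_neq0 z0)); rewrite mulfV // mulrAC -h1.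
  by have [] := node_inj q0 qI g (ltn0Sn k) (ltn_ord (lift ord0 j)) h2.
rewrite n00 /edge_val qprD !invrK invfM.
set W := (node_wt _ _ _ _ _)^-1; set X := qpr q (q ^- a / z) c in Xn0 *.
set Y := qpr q (z * _) c; move: (qpr _ _ b) (qpr q z a) (z^-1 ^ _) => B A Z.
by field.
Qed.

End Recursion.

(** * Evaluation of the constant factor *)

Lemma binomz2_double (m : int) : binomz2 m * 2 = m * (m - 1).
Proof.
have [r [->|->]] : exists r : int, m = r * 2 \/ m = r * 2 + 1.
  exists (m %/ 2)%Z; rewrite {1 3}(divz_eq m 2).
  have := modz_ge0 m (isT : (2 : int) != 0); have := ltz_pmod m (isT : (0 : int) < 2).
  by move: (m %% 2)%Z (m %/ 2)%Z => s d; lia.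
all: rewrite /binomz2; set z := (X in (X %/ 2)%Z).
  have -> : z = (r * (r * 2 - 1)) * 2 by rewrite /z; ring.
  by rewrite mulzK //; ring.
have -> : z = (r * (r * 2 + 1)) * 2 by rewrite /z; ring.
by rewrite mulzK //; ring.
Qed.

Section Constant.
Variables (K : fieldType) (q : K).
Hypothesis q0 : q != 0.
Hypothesis qI : forall n m, q ^+ n = q ^+ m -> n = m.
Variables (b c : nat).
Hypothesis c0 : (0 < c)%N.
Let e : int := b%:Z + 1 - c%:Z.
Let t := q ^+ c.

Lemma qpr_qn0 m : qpr q q m != 0.
Proof.
apply/prodf_neq0 => l _; rewrite -exprS subr_eq0 -{1}(expr0 q).
by apply/eqP => /qI.
Qed.

(** Each factor is [1 - q^-m = - q^-m (1 - q^m)] with [1 <= m <= a]. *)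
Lemma qpr_neg a : qpr q (q ^- a) a = (- 1) ^+ a * q ^ (- binomz2 (a%:Z + 1)) * qpr q q a.
Proof.
elim: a => [|a IH]; first by rewrite /qpr !big_ord0 /binomz2 /= expr0z !mulr1.
have -> : - binomz2 (a.+1%:Z + 1) = - binomz2 (a%:Z + 1) - a.+1%:Z.
  have := binomz2_double (a.+1%:Z + 1); have := binomz2_double (a%:Z + 1).
  move: (binomz2 _) (binomz2 _) => u v; lia.
rewrite expfzDr // [qpr q q _]/qpr big_ord_recr /= -/(qpr q q a).
rewrite [LHS]/qpr big_ord_recl expr0 mulr1.
have -> : \prod_(i < a) (1 - q ^- a.+1 * q ^+ lift ord0 i) = qpr q (q ^- a) a.
  apply: eq_bigr => i _; rewrite lift0 !exprS; congr (1 - _).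
  by rewrite invfM [q^-1 * _]mulrC -mulrA; congr (_ * _); rewrite mulKf.
rewrite IH -[q * q ^+ a]exprS -exprnN [(-1) ^+ a.+1]exprS.
have := expf_neq0 a.+1 q0; move: (q ^+ a.+1) (q ^ _) (qpr _ _ _) ((-1) ^+ a) => A B C D A0.
by field.
Qed.

(** The contribution of one recursion step to the constant: [qpr_neg] rewrites both symbols at
    negative powers, [(q)_a (q^(a+1))_b = (q)_(a+b)], and [a + b = a' + c - 1]. *)
Lemma edge_val_ratio a a' : a'%:Z = a%:Z + e ->
  edge_val q b c a (q ^+ a) / qpr q (q ^- a') a'
  = (- 1) ^ e * q ^ binomz2 (e + 1) * (qpr q q (a' + c.-1) / qpr q q a').
Proof.
move=> ha; rewrite /edge_val !qpr_neg -/e.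
have -> : (a' + c.-1 = a + b)%N by rewrite /e in ha; lia.
rewrite qprD.
have -> : (q ^+ a) ^ (- e) = q ^ (- (a%:Z * e)).
  by rewrite [q ^+ a]exprnP exprz_exp mulrN.
have -> : binomz2 (e + 1) = - binomz2 (a%:Z + 1) + - (a%:Z * e) + binomz2 (a'%:Z + 1).
  have h1 := binomz2_double (e + 1); have h2 := binomz2_double (a%:Z + 1).
  have h3 := binomz2_double (a'%:Z + 1).
  by rewrite ha in h3 *; move: (binomz2 _) (binomz2 _) (binomz2 _) h1 h2 h3 => u v w; nia.
have -> : (-1 : K) ^ e = (-1) ^+ a * (-1) ^+ a'.
  have -> : e = a'%:Z - a%:Z by lia.
  by rewrite expfzDr ?oppr_eq0 ?oner_eq0 // -exprnN -exprVn invrN1 mulrC.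
have q1 := qpr_qn0 a'.
rewrite !expfzDr // -[q ^ binomz2 (a'%:Z + 1)]invrK invr_expz.
have := expfz_neq0 (- binomz2 (a'%:Z + 1)) q0.
move: (q ^ (- binomz2 (a'%:Z + 1))) (q ^ (- binomz2 (a%:Z + 1))) (q ^ (- (a%:Z * e))) => A B C A0.
have -> : ((-1 : K) ^+ a' * A * qpr q q a')^-1 = (-1) ^+ a' * (A * qpr q q a')^-1.
  by rewrite !invfM invr_sign !mulrA.
move: (qpr q q a') q1 (qpr q q a) (qpr q _ b) ((-1) ^+ a) ((-1) ^+ a') => u u0 v w x y.
by field; rewrite A0 u0.
Qed.

(** For [B = c - 1] the quotient [(q)_((i+1)c) / (q)_(B+ic)] is the single factor [1 - t^(i+1)]. *)
Lemma morrisE k A :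
  morris q k A (c - 1) c
  = \prod_(i < k) (qpr q q (A + c.-1 + i * c) / (qpr q q (A + i * c) * qpr q q c))
    * \prod_(i < k) (1 - t ^+ i.+1).
Proof.
rewrite /morris -big_split; apply: eq_bigr => i _ /=.
have qE y m : qpoch q y m = qpr q y m by [].
rewrite !qE.
have -> : qpr q q (i.+1 * c) = qpr q q (c - 1 + i * c) * (1 - t ^+ i.+1).
  have -> : (i.+1 * c = (c - 1 + i * c).+1)%N by rewrite mulSn; lia.
  rewrite [LHS]/qpr big_ord_recr /= -exprS /t -exprM; congr (_ * (1 - _ ^+ _)).
  by rewrite (mulnC c) mulSn; lia.
have -> : (A + (c - 1) + i * c = A + c.-1 + i * c)%N by rewrite subn1.
have := qpr_qn0 (c - 1 + i * c); have := qpr_qn0 (A + i * c); have := qpr_qn0 c.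
move: (qpr q q _) (qpr q q _) (qpr q q _) (qpr q q _) => u v w x u0 w0 v0.
by field; rewrite ?u0 ?v0 ?w0.
Qed.

(** In [morrisE], replacing [A] by [A + c] shifts the index of the first product, so its first
    factor is split off; from the second product the last one is. *)
Lemma morris_rec k A :
  morris q k.+1 A (c - 1) c
  = qpr q q (A + c.-1) / qpr q q A / qpr q q c * (1 - t ^+ k.+1)
    * morris q k (A + c) (c - 1) c.
Proof.
rewrite !morrisE [X in X * _ = _]big_ord_recl [X in _ * X = _]big_ord_recr /=.
have -> : \prod_(i < k) (qpr q q (A + c.-1 + bump 0 i * c) / (qpr q q (A + bump 0 i * c) * qpr q q c))
  = \prod_(i < k) (qpr q q (A + c + c.-1 + i * c) / (qpr q q (A + c + i * c) * qpr q q c)).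
  apply: eq_bigr => i _; rewrite -[bump 0 i]/(i.+1) mulSn.
  have -> : (A + c.-1 + (c + i * c) = A + c + c.-1 + i * c)%N by lia.
  by have -> : (A + (c + i * c) = A + c + i * c)%N by lia.
rewrite mul0n !addn0 invfM.
move: (\prod_(i < k) _) (\prod_(i < k) _) => X Y.
ring.
Qed.

Lemma symsum0 a x : symsum q b c a 0 x = 1.
Proof.
rewrite /symsum (eq_bigr (fun=> 1)) => [|g _]; last by rewrite !big_ord0 mulr1.
by rewrite sumr_const card_ffun !card_ord expn0.
Qed.

(* Comparing both evaluations of the sum at a point with [x 0 = q ^- a']
   relates the constants for [(k + 1, a)] and [(k, a + c)]. *)
Lemma fsum_const (R : comNzRingType) (io : {rmorphism R -> K}) (p : R) k a a'
    (y : nat -> K) :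
  io p = q -> generic q k y -> a'%:Z = a%:Z + e ->
  fsum io (mlist k a b c p) [::]
  = ((- 1) ^ e * q ^ binomz2 (e + 1)) ^+ k * morris q k a' (c - 1) c.
Proof.
move=> iop; have t1 m : 1 - t ^+ m.+1 != 0.
  rewrite subr_eq0 -(expr0 q) -exprM; apply/eqP => /qI /esym/eqP.
  by rewrite muln_eq0 orbF => /eqP cz; have := c0; rewrite cz.
elim: k a a' => [|k IH] a a' gy ha.
  have := fsum_factor q0 qI c0 iop ha gy.
  rewrite (fsum_symsum q0 qI _ c0 _ iop) // symsum0 !big_ord0 !mulr1 => <-.
  by rewrite /morris big_ord0 mulr1.
(* The scaling that moves the first coordinate to [q ^- a']. *)
pose s := q ^- a' / y 0%N.
have y00 : y 0%N != 0 by have [h _] := gy; exact: h.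
have s0 : s != 0 by rewrite mulf_neq0 ?invr_eq0 ?expf_neq0.
pose x j := s * y j.
have gx : generic q k.+1 x by apply: generic_scale.
have x0 : x 0%N * q ^+ a' = 1.
  by rewrite /x /s divfK // mulVf // expf_neq0.
have gx' : generic q k (x \o succn).
  have [h1 h2] := gx; split=> [j jk|i j n m ik jk]; first exact: h1.
  by move=> h; have [] := h2 i.+1 j.+1 n m ik jk h.
have ha' : (a' + c)%N%:Z = (a + c)%N%:Z + e by rewrite !PoszD ha; ring.
have F1 := fsum_factor q0 qI c0 iop ha (gx).
have F2 := fsum_factor q0 qI c0 iop ha' gx'.
rewrite (fsum_symsum q0 qI _ c0 _ iop) // (symsum_rec q0 qI c0 ha (gx) x0) in F1.
rewrite (fsum_symsum q0 qI _ c0 _ iop) // (IH _ _ _ ha') in F2; last first.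
  have [h1 h2] := gy; split=> [j jk|i j n m ik jk]; first by apply: h1; rewrite ltnW.
  by apply: h2; rewrite ltnW.
have x0E : x 0%N = q ^- a' by apply: (mulIf (expf_neq0 a' q0)); rewrite x0 mulVf // expf_neq0.
rewrite [X in X * _ = _]big_ord_recr /= [X in _ = _ * X]big_ord_recl -/t in F1.
(* Since [x 0] is an inverse power of [q], genericity keeps the other coordinates away from such
   powers, and the factors to be cancelled are nonzero. *)
have nz j m : (j < k)%N -> qpr q (x j.+1) m != 0.
  move=> jk; apply/prodf_neq0 => l _; rewrite subr_eq0 -x0; apply/eqP => h.
  by have [_ h2] := gx; have := h2 0%N j.+1 _ _ isT jk h.
have P1 : \prod_(j < k) qpr q (x j.+1) a' != 0 by apply/prodf_neq0 => j _; exact: nz.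
have EP : \prod_(j < k) qpr q (x j.+1) (a' + c)
  = \prod_(j < k) qpr q (x j.+1) a' * \prod_(j < k) qpr q (q ^+ a' * x j.+1) c.
  by rewrite -big_split; apply: eq_bigr => j _; rewrite qprD [_ * q ^+ _]mulrC.
have P2 : \prod_(j < k) qpr q (q ^+ a' * x j.+1) c != 0.
  have : \prod_(j < k) qpr q (x j.+1) (a' + c) != 0 by apply/prodf_neq0 => j _; exact: nz.
  by rewrite EP mulf_eq0 negb_or => /andP[].
have qc0 : qpr q q c.-1 != 0 := qpr_qn0 _.
have qcE : qpr q q c = qpr q q c.-1 * (1 - t).
  by rewrite -{1}(prednK c0) [LHS]/qpr big_ord_recr /= -exprS (prednK c0).
have n0 : qpr q (q ^- a') a' != 0.
  by rewrite qpr_neg !mulf_neq0 ?qpr_qn0 ?expfz_neq0 // signr_eq0.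
have edgeE : edge_val q b c a (q ^+ a) = (- 1) ^ e * q ^ binomz2 (e + 1)
    * (qpr q q (a' + c.-1) / qpr q q a') * qpr q (q ^- a') a'.
  by rewrite -(edge_val_ratio ha) divfK.
rewrite morris_rec exprS; apply: (mulIf n0); apply: (mulIf P1).
rewrite -mulrA -x0E -[LHS]F1 x0E prodfV edgeE qcE.
move: F2; rewrite EP -/t => F2.
set T := \prod_(i < k) (_ / _) in F2 *; set S := symsum _ _ _ _ _ _ in F2 *.
set M := morris _ _ _ _ _ in F2 *.
set U := (- 1) ^ e * _ in F2 *.
set P := \prod_(j < k) _ in F2 *.
move: (\prod_(j < k) qpr q (q ^+ a' * x j.+1) c) F2 P2 => Q2 F2 Q20.
move: (t1 0%N) (qpr_qn0 a'); rewrite expr1.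
move: (qpr q q (a' + _)) (qpr q q a') (qpr q q c.-1) qc0 (1 - t) (1 - t ^+ _)
  (qpr q (q ^- a') a') (U ^+ k) F2 => A B C C0 D E G H F2 D0 B0.
(* [T * S] is the sum for [k] variables and [a + c], known from [F2]. *)
transitivity (T * S * (E / D * (U * (A / B) * G / C / Q2))); first by ring.
by rewrite F2; field; rewrite Q20 C0 B0 D0.
Qed.

End Constant.

(** * Specialization to commutative rings *)

Lemma map_nodeseq (A B : comNzRingType) (f : {rmorphism A -> B}) d q x k c :
  map f (nodeseq d q x k c) = nodeseq (f d) (f q) (f \o x) k c.
Proof.
by rewrite /nodeseq map_allpairs; apply: eq_allpairs => j l /=; rewrite !rmorphM rmorphXn.
Qed.

Lemma fsum_rmorph (I : finType) (R A B : comNzRingType) (io : R -> A)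
    (f : {rmorphism A -> B}) (L : seq (R * expo I)) s :
  fsum (f \o io) L (map f s) = f (fsum io L s).
Proof.
rewrite /fsum rmorph_sum; apply: eq_bigr => x _ /=; rewrite rmorphM rmorph_prod.
by congr (_ * _); apply: eq_bigr => i _; rewrite chomz_rmorph.
Qed.

Lemma qpr_rmorph (A B : comNzRingType) (f : {rmorphism A -> B}) q y m :
  qpr (f q) (f y) m = f (qpr q y m).
Proof.
by rewrite /qpr rmorph_prod; apply: eq_bigr => l _; rewrite rmorphB rmorph1 rmorphM rmorphXn.
Qed.

Lemma morris_rmorph (E K : fieldType) (f : {rmorphism E -> K}) q k a b c :
  morris (f q) k a b c = f (morris q k a b c).
Proof.
rewrite /morris rmorph_prod; apply: eq_bigr => i _.
by rewrite rmorphM fmorphV !rmorphM -!qpr_rmorph.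
Qed.

(* Proved at algebraically independent [x j], then specialized. *)
Lemma fsum_eval (F : fieldType) (q : F) (A : comNzRingType) (io : {rmorphism F -> A})
    (a b c a' k : nat) (x : nat -> A) (e := b%:Z + 1 - c%:Z) :
  q != 0 -> (forall n m, q ^+ n = q ^+ m -> n = m) -> (0 < c)%N ->
  a'%:Z = a%:Z + e ->
  fsum io (mlist k a b c q) (nodeseq (io (q ^ e)) (io q) x k c)
  = io (((- 1) ^ e * q ^ binomz2 (e + 1)) ^+ k * morris q k a' (c - 1) c)
    * \prod_(j < k) qpr (io q) (x j) a'.
Proof.
move=> q0 qI c0 ha.
pose P := {mpoly F[k]}; pose C : {rmorphism F -> P} := @mpolyC k F.
pose T : {rmorphism P -> {fraction P}} := @tofrac P.
pose J : {rmorphism F -> {fraction P}} := T \o C.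
pose X (j : nat) : P := if insub j is Some i then 'X_i else 0.
have XE (i : 'I_k) : X i = 'X_i by rewrite /X valK.
have TI : injective T by move=> u v /eqP; rewrite tofrac_eq => /eqP.
have Jq0 : J q != 0 by rewrite fmorph_eq0.
have JqI n m : J q ^+ n = J q ^+ m -> n = m.
  by rewrite -!rmorphXn => /fmorph_inj /qI.
have gX : generic (J q) k (T \o X).
  split=> [j jk|i j n m ik jk] /=.
    rewrite -(rmorph0 T) (inj_eq TI) -[j]/(val (Ordinal jk)) XE.
    apply/eqP => /(congr1 (fun u : P => u@_(U_(Ordinal jk)%MM))).
    by rewrite mcoeffX eqxx mcoeff0; apply/eqP; rewrite oner_eq0.
  rewrite /J /= -!rmorphXn -!rmorphM => /TI.
  rewrite -[i]/(val (Ordinal ik)) -[j]/(val (Ordinal jk)) !XE.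
  rewrite ![_ * C _]mulrC /C /= !mul_mpolyC.
  move/(congr1 (fun u : P => u@_(U_(Ordinal ik)%MM))).
  rewrite !mcoeffZ !mcoeffXU eqxx mulr1; case: eqP => [[->] //|_].
  by move/eqP; rewrite mulr0 (negbTE (expf_neq0 n q0)).
have := fsum_factor (p := q) (io := J) Jq0 JqI c0 erefl ha gX.
rewrite (fsum_const (p := q) (io := J) Jq0 JqI c0 erefl gX ha).
rewrite -!/e -fmorphXz -fmorphXz -(rmorph1 J) -rmorphN -fmorphXz -rmorphM -rmorphXn morris_rmorph -rmorphM.
have -> : \prod_(j < k) qpr (J q) ((T \o X) j) a' = T (\prod_(j < k) qpr (C q) (X j) a').
  by rewrite rmorph_prod; apply: eq_bigr => j _; rewrite -qpr_rmorph.
rewrite -(map_nodeseq T (C (q ^ e)) (C q)) (fsum_rmorph C T).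
rewrite -[J (_ * _)]/(T (C _)) -rmorphM => /TI.
(* As [T] is injective, the identity already holds between polynomials; [M] specializes the unknowns
   to the [x j]. *)
pose M : {rmorphism P -> A} := mmap io (fun i : 'I_k => x i).
have MC u : M (C u) = io u by exact: mmapC.
move/(congr1 M); rewrite rmorphM MC => H.
have xsE : nodeseq (io (q ^ e)) (io q) x k c = map M (nodeseq (C (q ^ e)) (C q) X k c).
  rewrite map_nodeseq !MC; apply/eq_in_allpairs => j l; rewrite mem_index_iota /= => jk _.
  by rewrite -[j]/(val (Ordinal jk)) XE /M /= mmapX mmap1U.
rewrite -fsum_rmorph -xsE rmorph_prod in H.
transitivity (fsum (M \o C) (mlist k a b c q) (nodeseq (io (q ^ e)) (io q) x k c)).
  by apply: eq_bigr => y _; rewrite /= -MC.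
rewrite H; congr (_ * _); apply: eq_bigr => j _.
by rewrite -qpr_rmorph MC XE /M /= mmapX mmap1U.
Qed.

(** * A ring of formal series *)

Section NovikovRing.
Variables (I : finType) (F : fieldType) (om : {additive expo I -> int}).
Implicit Types (f g h : lseries I F) (u v w : expo I) (s : seq (expo I)).

Definition wgt u : int := om u.
Lemma wgtB u v : wgt (u - v) = wgt u - wgt v.
Proof. by rewrite /wgt raddfB. Qed.

Lemma lmulE f g u s : uniq s ->
  (forall v, f v != 0 -> g (u - v) != 0 -> v \in s) ->
  lmul f g u = \sum_(v <- s) f v * g (u - v).
Proof.
move=> us hs; rewrite fsbig_seq //; apply/esym/fsbig_widen => // v [_ /= vs].
apply/eqP; apply: contra_notT vs; rewrite mulf_eq0 negb_or => /andP[fv gv].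
exact: hs.
Qed.

Definition covers f (N : int) s := uniq s /\ forall v, f v != 0 -> wgt v <= N -> v \in s.
Definition above f (m : int) := forall v, f v != 0 -> m <= wgt v.
(** Finitely many exponents below each weight, as in a Novikov ring: the coefficients of products
    are then finite sums, and such series form a ring. *)
Definition novikov f := forall N, exists s, covers f N s.

Lemma novikov_intro f : (forall N, exists s, forall v, f v != 0 -> wgt v <= N -> v \in s) ->
  novikov f.
Proof.
move=> h N; have [s hs] := h N; exists (undup s).
by split=> [|v fv Nv]; rewrite ?undup_uniq // mem_undup hs.
Qed.

Lemma novikov_above f : novikov f -> exists m, above f m.
Proof.
(* All exponents of weight at most 0 lie in [s], so this bounds their weights from below, and
   positive weights trivially. *)
move=> /(_ 0)[s [_ hs]]; exists (- \sum_(v <- s) `|wgt v|) => v fv.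
have [v0|/ltW v0] := leP (wgt v) 0; last first.
  by rewrite (le_trans _ v0) // oppr_le0 sumr_ge0.
rewrite lerNl (big_rem v) ?hs //=; apply: le_trans (ler_norm (- wgt v)) _.
by rewrite normrN lerDl sumr_ge0.
Qed.

(** An exponent [v] of [f] matters only if [u - v] has weight at least [m]. *)
Lemma lmul_covers f g u N m s : covers f N s -> above g m -> wgt u - m <= N ->
  lmul f g u = \sum_(v <- s) f v * g (u - v).
Proof.
move=> [us hs] hg hN; apply: lmulE => // v fv gv; apply: hs => //.
by have := hg _ gv; rewrite wgtB; lia.
Qed.

Lemma lmul_neq0 f g u : novikov f -> novikov g -> lmul f g u != 0 ->
  exists v, f v != 0 /\ g (u - v) != 0.
Proof.
move=> nf ng; have [m hm] := novikov_above ng; have [s hs] := nf (wgt u - m).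
rewrite (lmul_covers hs hm) //; case: (boolP (has (fun v => f v * g (u - v) != 0) s)).
  by move=> /hasP[v _]; rewrite mulf_eq0 negb_or => /andP[fv gv] _; exists v.
move=> /hasPn h; rewrite big1_seq ?eqxx // => v /andP[_ vs].
by apply/eqP; have := h _ vs; rewrite negbK.
Qed.

Lemma above_mul f g m m' : novikov f -> novikov g -> above f m -> above g m' ->
  above (lmul f g) (m + m').
Proof.
move=> nf ng hf hg u /(lmul_neq0 nf ng)[v [/hf fv /hg gv]].
by rewrite wgtB in gv; lia.
Qed.

Lemma novikov_mul f g : novikov f -> novikov g -> novikov (lmul f g).
Proof.
move=> nf ng; apply: novikov_intro => N.
have [m hm] := novikov_above nf; have [m' hm'] := novikov_above ng.
have [s [_ hs]] := nf (N - m'); have [s' [_ hs']] := ng (N - m).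
exists [seq v + w | v <- s, w <- s'] => u /(lmul_neq0 nf ng)[v [fv gv]] uN.
have fm := hm _ fv; have gm := hm' _ gv; have := gm; rewrite wgtB => gm'.
apply/allpairsP; exists (v, u - v); split => /=; last by rewrite addrC subrK.
  by apply: hs => //; lia.
by apply: hs' => //; rewrite wgtB; lia.
Qed.

Lemma lmulC f g : novikov f -> novikov g -> lmul f g = lmul g f.
Proof.
move=> nf ng; apply/funext => u; have [m hm] := novikov_above ng.
have [s [us hs]] := nf (wgt u - m).
have hs' v : f v != 0 -> g (u - v) != 0 -> v \in s.
  by move=> fv gv; apply: hs => //; have := hm _ gv; rewrite wgtB; lia.
rewrite (lmulE us hs') (@lmulE g f u [seq u - v | v <- s]).
- by rewrite big_map; apply: eq_bigr => v _; rewrite subKr mulrC.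
- by rewrite map_inj_uniq // => v w /addrI /oppr_inj.
- move=> v gv fv; apply/mapP; exists (u - v); last by rewrite subKr.
  by apply: hs' => //; rewrite subKr.
Qed.

Lemma lmulA f g h : novikov f -> novikov g -> novikov h ->
  lmul f (lmul g h) = lmul (lmul f g) h.
Proof.
move=> nf ng nh; have nfg := novikov_mul nf ng; have ngh := novikov_mul ng nh.
rewrite [RHS]lmulC //; apply/funext => u.
have [mf hf] := novikov_above nf; have [mg hg] := novikov_above ng.
have [mh hh] := novikov_above nh.
have [s cs] := nf (wgt u - mg - mh); have [r cr] := nh (wgt u - mf - mg).
rewrite (lmul_covers cs (above_mul ng nh hg hh)); last by lia.
rewrite (lmul_covers cr (above_mul nf ng hf hg)); last by lia.
(* Both sides are sums over the exponents [v] of [f] and [w] of [h], that of [g] being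
   [u - v - w]. *)
transitivity (\sum_(v <- s) \sum_(w <- r) f v * (h w * g (u - v - w))).
  apply: eq_bigr => v _; rewrite -mulr_sumr; have [->|fv] := eqVneq (f v) 0.
    by rewrite !mul0r.
  congr (_ * _); rewrite lmulC // (lmul_covers cr hg) //.
  by have := hf _ fv; rewrite wgtB; lia.
rewrite exchange_big; apply: eq_bigr => w _; have [->|hw] := eqVneq (h w) 0.
  by rewrite mul0r big1 // => v _; rewrite mul0r mulr0.
rewrite (lmul_covers cs hg); last by have := hh _ hw; rewrite wgtB; lia.
by rewrite mulr_sumr; apply: eq_bigr => v _; rewrite mulrCA addrAC.
Qed.

Lemma lmul_monom d e f u : lmul (lmonom d e) f u = d * f (u - e).
Proof.
rewrite (@lmulE _ _ u [:: e]) //; first by rewrite big_seq1 /lmonom eqxx.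
move=> v; rewrite /lmonom inE; case: (v == e) => //; by rewrite eqxx.
Qed.

Lemma lmul_one f : lmul (@lone I F) f = f.
Proof. by apply/funext => u; rewrite lmul_monom mul1r subr0. Qed.

Lemma novikov_add f g : novikov f -> novikov g -> novikov (fun u => f u + g u).
Proof.
move=> nf ng; apply: novikov_intro => N.
have [s [_ hs]] := nf N; have [s' [_ hs']] := ng N; exists (s ++ s') => v fgv vN.
rewrite mem_cat; have [fv|fv] := eqVneq (f v) 0; last by rewrite hs.
by rewrite hs' ?orbT //; move: fgv; rewrite fv add0r.
Qed.

Lemma novikov_opp f : novikov f -> novikov (fun u => - f u).
Proof.
move=> nf; apply: novikov_intro => N; have [s [_ hs]] := nf N; exists s => v.
by rewrite oppr_eq0; apply: hs.
Qed.

Lemma novikov_monom d e : novikov (lmonom d e).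
Proof.
apply: novikov_intro => N; exists [:: e] => v; rewrite /lmonom inE.
by case: (v == e) => //; rewrite eqxx.
Qed.

Lemma novikov_zero : novikov (fun=> 0).
Proof. by apply: novikov_intro => N; exists [::] => v; rewrite eqxx. Qed.

Lemma lmulDl f g h : novikov f -> novikov g -> novikov h ->
  lmul (fun u => f u + g u) h = (fun u => lmul f h u + lmul g h u).
Proof.
move=> nf ng nh; rewrite !(@lmulC _ h) //; last exact: novikov_add.
apply/funext => u.
have [mf hf] := novikov_above nf; have [mg hg] := novikov_above ng.
have [s cs] := nh (wgt u - Num.min mf mg).
have hfg : above (fun u => f u + g u) (Num.min mf mg).
  move=> v; have [fv|/hf fv _] := eqVneq (f v) 0; last by rewrite ge_min fv.
  by rewrite fv add0r => /hg gv; rewrite ge_min gv orbT.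
rewrite (lmul_covers cs hfg) // (lmul_covers cs hf); last by lia.
rewrite (lmul_covers cs hg); last by lia.
by rewrite -big_split; apply: eq_bigr => v _; rewrite mulrDr.
Qed.

Record nser := Nser { nval : lseries I F; nvalP : novikov nval }.

Lemma nval_inj : injective nval.
Proof. by move=> [f nf] [g ng] /= fg; subst g; congr Nser; exact: Prop_irrelevance. Qed.

HB.instance Definition _ := gen_eqMixin nser.
HB.instance Definition _ := gen_choiceMixin nser.

Definition nadd x y := Nser (novikov_add (nvalP x) (nvalP y)).
Definition nopp x := Nser (novikov_opp (nvalP x)).
Definition nzero := Nser novikov_zero.
(* Locked, so that simplification does not unfold products in this ring. *)
Fact nmul_key : unit. Proof. by []. Qed.
Definition nmul :=
  locked_with nmul_key (fun x y => Nser (novikov_mul (nvalP x) (nvalP y))).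
Lemma nval_mul x y : nval (nmul x y) = lmul (nval x) (nval y).
Proof. by rewrite /nmul unlock. Qed.
Definition nmono d e := Nser (novikov_monom d e).

Lemma naddA : associative nadd.
Proof. by move=> x y z; apply/nval_inj/funext => u /=; rewrite addrA. Qed.
Lemma naddC : commutative nadd.
Proof. by move=> x y; apply/nval_inj/funext => u /=; rewrite addrC. Qed.
Lemma nadd0 : left_id nzero nadd.
Proof. by move=> x; apply/nval_inj/funext => u /=; rewrite add0r. Qed.
Lemma naddN : left_inverse nzero nopp nadd.
Proof. by move=> x; apply/nval_inj/funext => u /=; rewrite addNr. Qed.

HB.instance Definition _ := GRing.isZmodule.Build nser naddA naddC nadd0 naddN.

Lemma nmulA : associative nmul.
Proof. by move=> x y z; apply/nval_inj; rewrite !nval_mul; apply: lmulA; apply: nvalP. Qed.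
Lemma nmulC : commutative nmul.
Proof. by move=> x y; apply/nval_inj; rewrite !nval_mul; apply: lmulC; apply: nvalP. Qed.
Lemma nmul1 : left_id (nmono 1 0) nmul.
Proof. by move=> x; apply/nval_inj; rewrite nval_mul; exact: lmul_one. Qed.
Lemma nmulDl : left_distributive nmul +%R.
Proof.
move=> x y z; apply/nval_inj; rewrite nval_mul lmulDl; [|exact: nvalP..].
by apply/funext => u; rewrite /= !nval_mul.
Qed.
Lemma none_neq0 : nmono 1 0 != 0.
Proof.
apply/eqP => /(congr1 (fun x => nval x 0)) /=; rewrite /lmonom eqxx => /eqP.
by rewrite oner_eq0.
Qed.

HB.instance Definition _ :=
  GRing.Zmodule_isComNzRing.Build nser nmulA nmulC nmul1 nmulDl none_neq0.

End NovikovRing.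

(** * Geometric series and constant terms *)

Section Novikov.
Variables (I : finType) (F : fieldType) (om : {additive expo I -> int}).
Local Notation N := (nser F om).
Local Notation mono := (@nmono I F om).
Implicit Types (x y : N) (u v e : expo I) (i : I) (c d : F).

Lemma nvalM x y : nval (x * y) = lmul (nval x) (nval y).
Proof. exact: nval_mul. Qed.
Lemma nval1 : nval (1 : N) = @lone I F. Proof. by []. Qed.
Lemma nvalD x y u : nval (x + y) u = nval x u + nval y u. Proof. by []. Qed.

Lemma nval_prod (J : Type) (r : seq J) (P : pred J) (f : J -> N) :
  nval (\prod_(j <- r | P j) f j) = \big[@lmul I F/@lone I F]_(j <- r | P j) nval (f j).
Proof. exact: (big_morph _ nvalM nval1). Qed.

Lemma nval_mono d e x u : nval (mono d e * x) u = d * nval x (u - e).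
Proof. by rewrite nvalM; exact: lmul_monom. Qed.

Lemma monoM c d u v : mono (c * d) (u + v) = mono c u * mono d v.
Proof.
apply/nval_inj/funext => w; rewrite nval_mono /= /lmonom.
rewrite -[w == _]subr_eq0 opprD addrA -[w - u == _]subr_eq0.
by case: eqP; rewrite ?mulr0.
Qed.

Lemma nval_factor d e : nval (1 - mono d e) = lfactor d e. Proof. by []. Qed.

Definition nC (d : F) : N := mono d 0.
Lemma nC_additive : zmod_morphism nC.
Proof.
move=> c d; apply/nval_inj/funext => u /=; rewrite /lmonom.
by case: eqP; rewrite ?subr0.
Qed.
Lemma nC_multiplicative : monoid_morphism nC.
Proof. by split=> // c d; rewrite -monoM addr0. Qed.
HB.instance Definition _ := GRing.isZmodMorphism.Build F N nC nC_additive.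
HB.instance Definition _ := GRing.isMonoidMorphism.Build F N nC nC_multiplicative.

Lemma mono_nC d u : mono d u = nC d * mono 1 u.
Proof. by rewrite -monoM mulr1 add0r. Qed.

Lemma lgeom_at d e m : 0 < wgt om e -> lgeom d e (e *+ m) = d ^+ m.
Proof.
move=> e0; have wM n : wgt om (e *+ n) = wgt om e *+ n by rewrite /wgt raddfMn.
rewrite /lgeom -(@fsbig_widen _ _ _ _ [set m]) ?fsbig_set1 /lmonom ?eqxx //.
move=> n [_ /= nm]; rewrite ifN //; apply/eqP => /(congr1 (wgt om)); rewrite !wM.
by move/(mulrIn (lt0r_neq0 e0)) => mn; apply: nm.
Qed.

Lemma lgeom_out d e u : (forall m, u <> e *+ m) -> lgeom d e u = 0.
Proof.
move=> h; rewrite /lgeom fsbig1 // => m _; rewrite /lmonom ifN //.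
by apply/eqP/h.
Qed.

Lemma novikov_geom d e : 0 < wgt om e -> novikov om (lgeom d e).
Proof.
move=> e0; apply: novikov_intro => B.
exists [seq e *+ m | m <- iota 0 `|B|.+1] => u.
have [[m ->] _|h] := pselect (exists m, u = e *+ m); last first.
  by rewrite lgeom_out ?eqxx // => m um; apply: h; exists m.
have -> : wgt om (e *+ m) = wgt om e *+ m by rewrite /wgt raddfMn.
move=> mB; apply: map_f; rewrite mem_iota /= add0n ltnS.
by move: (wgt om e) e0 mB => w w0; rewrite -mulr_natr natz; nia.
Qed.

(** The default value 0 covers exponents without positive weight, for which the series need not be
    in the ring. *)
Definition ngeom d e : N :=
  if pselect (0 < wgt om e) is left h then Nser (novikov_geom d h) else 0.

Lemma nval_geom d e : 0 < wgt om e -> nval (ngeom d e) = lgeom d e.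
Proof. by move=> e0; rewrite /ngeom; case: pselect. Qed.

Lemma ngeomE d e : 0 < wgt om e -> ngeom d e = 1 + mono d e * ngeom d e.
Proof.
move=> e0; apply/nval_inj/funext => u; rewrite nvalD nval_mono nval_geom //.
rewrite /= /lmonom.
have w0 m : e *+ m.+1 <> 0.
  move/(congr1 (wgt om)); rewrite /wgt raddfMn raddf0 => /eqP.
  by rewrite mulrn_eq0 /= => /eqP h; rewrite /wgt h ltxx in e0.
have wN m : - e <> e *+ m.
  by move=> h; apply: (w0 m); rewrite mulrS -h subrr.
have [[[|m] ->]|h] := pselect (exists m, u = e *+ m).
- by rewrite mulr0n eqxx -(mulr0n e) lgeom_at // expr0 sub0r lgeom_out ?mulr0 ?addr0.
- rewrite lgeom_at // ifN; last exact/eqP/w0.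
  by rewrite add0r mulrSr addrK lgeom_at // exprS.
rewrite lgeom_out; last by move=> m um; apply: h; exists m.
rewrite ifN; last by apply/eqP => u0; apply: h; exists 0%N; rewrite mulr0n.
rewrite lgeom_out ?mulr0 ?addr0 // => m um; apply: h; exists m.+1.
by rewrite mulrS -um addrC subrK.
Qed.

Definition supp (P : expo I -> Prop) x := forall u, nval x u != 0 -> P u.
Definition zfree i := supp (fun u => u i = 0).
Definition nonneg i := supp (fun u => 0 <= u i).

Lemma supp_mul (P Q R : expo I -> Prop) x y :
  (forall u v, P u -> Q v -> R (u + v)) -> supp P x -> supp Q y -> supp R (x * y).
Proof.
move=> h hx hy u; rewrite nvalM => /(lmul_neq0 (nvalP x) (nvalP y))[v [/hx xv /hy yv]].
by rewrite -(subrK v u) addrC; apply: h.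
Qed.

Lemma supp_mono (P : expo I -> Prop) d u : P u -> supp P (mono d u).
Proof. by move=> Pu v; rewrite /= /lmonom; case: (v =P u) => [->|_] //; rewrite eqxx. Qed.

Lemma supp_add (P : expo I -> Prop) x y : supp P x -> supp P y -> supp P (x + y).
Proof.
move=> hx hy u; rewrite nvalD; have [x0|/hx //] := eqVneq (nval x u) 0.
by rewrite x0 add0r; apply: hy.
Qed.

Lemma supp_geom (P : expo I -> Prop) d e : (forall m, P (e *+ m)) -> 0 < wgt om e ->
  supp P (ngeom d e).
Proof.
move=> h e0 u; rewrite nval_geom //.
have [[m ->] _|k] := pselect (exists m, u = e *+ m); first exact: h.
by rewrite lgeom_out ?eqxx // => m um; apply: k; exists m.
Qed.

Section Submonoid.
Variable P : expo I -> Prop.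
Hypothesis P0 : P 0.
Hypothesis PD : forall u v, P u -> P v -> P (u + v).

Lemma supp_one : supp P 1. Proof. exact: supp_mono. Qed.
Lemma supp_zero : supp P 0. Proof. by move=> u; rewrite eqxx. Qed.

Lemma supp_prod (J : Type) (r : seq J) (Q : pred J) (f : J -> N) :
  (forall j, Q j -> supp P (f j)) -> supp P (\prod_(j <- r | Q j) f j).
Proof.
move=> h; elim/big_rec: _ => [|j x Qj hx]; first exact: supp_one.
by apply: supp_mul PD _ hx; exact: h.
Qed.

Lemma supp_chomz (s : seq N) m : (forall x, x \in s -> supp P x) -> supp P (chomz s m).
Proof.
move=> h; case: m => n; last exact: supp_zero.
rewrite /chomz; elim: s h n => [|x s IH] h n /=.
  by case: n => [|n]; [exact: supp_one | exact: supp_zero].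
elim/big_rec: _ => [|i y _ hy]; first exact: supp_zero.
apply: supp_add => //; apply: (supp_mul PD); last first.
  by apply: IH => z zs; apply: h; rewrite inE zs orbT.
elim: (nat_of_ord i) => [|m IHm]; first by rewrite expr0; exact: supp_one.
by rewrite exprS; apply: (supp_mul PD) IHm; apply: h; rewrite inE eqxx.
Qed.

End Submonoid.

Definition ct x : F := nval x 0.
Arguments ct : simpl never.
Lemma ctD x y : ct (x + y) = ct x + ct y. Proof. by []. Qed.

Lemma zfree0 i : (fun u : expo I => u i = 0) 0. Proof. by rewrite /= ffunE. Qed.
Lemma zfreeD i u v : u i = 0 -> v i = 0 -> (u + v) i = 0.
Proof. by rewrite ffunE => -> ->. Qed.
Lemma zfreeM i x y : zfree i x -> zfree i y -> zfree i (x * y).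
Proof. exact: supp_mul (zfreeD (i := i)). Qed.
Lemma zfree_prod i (J : Type) (r : seq J) (Q : pred J) (f : J -> N) :
  (forall j, Q j -> zfree i (f j)) -> zfree i (\prod_(j <- r | Q j) f j).
Proof. exact: supp_prod (zfree0 i) (zfreeD (i := i)) _ _ _ _. Qed.
Lemma nonneg0 i : (fun u : expo I => 0 <= u i) 0. Proof. by rewrite /= ffunE. Qed.
Lemma nonnegD i u v : 0 <= u i -> 0 <= v i -> 0 <= (u + v) i.
Proof. by rewrite ffunE; apply: addr_ge0. Qed.

Definition zpow i (m : int) : N := mono 1 (evar i *~ m).

Lemma zpowS i m : zpow i (m + 1) = zpow i m * zpow i 1.
Proof. by rewrite /zpow -monoM mulr1 mulrzDr. Qed.

(* Geometric series [g] in [D * z_i] satisfy [g = 1 + D * z_i * g]; unfolding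
   this equation gives the recursion defining [chomz]. *)
Lemma ct_elim1 i (gs : seq (N * N)) m y :
  (forall p, p \in gs -> [/\ zfree i p.1, nonneg i p.2 & p.2 = 1 + p.1 * zpow i 1 * p.2]) ->
  zfree i y ->
  ct (zpow i m * \prod_(p <- gs) p.2 * y) = ct (chomz [seq p.1 | p <- gs] (- m) * y).
Proof.
elim: gs m y => [|[D g] gs IH] m y hgs hy.
  rewrite big_nil mulr1 [[seq _ | _ <- _]]/= chomz_nil oppr_eq0.
  have [->|m0] := eqVneq m 0; first by rewrite /zpow mulr0z.
  rewrite mulr0n mul0r /ct [RHS]/= /zpow nval_mono mul1r; apply/eqP.
  apply: contraNT m0 => /hy /eqP; rewrite sub0r !ffunE evarM eqxx oppr_eq0.
  by [].
have hgs' p : p \in gs -> [/\ zfree i p.1, nonneg i p.2 & p.2 = 1 + p.1 * zpow i 1 * p.2].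
  by move=> pg; apply: hgs; rewrite inE pg orbT.
have [/= hD hg eg] := hgs (D, g) (mem_head _ _).
(* With a positive power of [z_i] in front and no negative power elsewhere, there is no constant
   term. *)
have pos m' y' : 0 < m' -> zfree i y' -> ct (zpow i m' * \prod_(p <- (D, g) :: gs) p.2 * y') = 0.
  move=> m0 hy'; rewrite -mulrA /ct /zpow nval_mono mul1r; apply/eqP.
  have : nonneg i (\prod_(p <- (D, g) :: gs) p.2 * y').
    apply: (supp_mul (P := fun u => 0 <= u i) (Q := fun u => u i = 0)) hy'.
      by move=> u v hu hv; rewrite ffunE hv addr0.
    rewrite big_seq; apply: supp_prod; [exact: nonneg0 | exact: nonnegD | ].
    by move=> p /hgs[].
  move=> H; apply/negPn/negP => /H; rewrite sub0r !ffunE evarM eqxx.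
  by rewrite oppr_ge0 leNgt m0.
have [m0|m0] := ltP 0 m; first by rewrite pos // chom_neg ?oppr_lt0 // mul0r.
have [n ->] : exists n : nat, m = - n%:Z by exists `|m|%N; rewrite lez0_abs // opprK.
(* Unfolding [g] once leaves the product without [g], known by induction on [gs], and the full
   product with an extra [D * z_i]. Iterating raises the power of [z_i] until it is positive. *)
have step m' y' : zfree i y' ->
    (ct (zpow i (m' + 1) * \prod_(p <- (D, g) :: gs) p.2 * (D * y'))
      = ct (chomz (D :: [seq p.1 | p <- gs]) (- (m' + 1)) * (D * y'))) ->
    ct (zpow i m' * \prod_(p <- (D, g) :: gs) p.2 * y')
    = ct (chomz (D :: [seq p.1 | p <- gs]) (- m') * y').
  move=> hy' H; rewrite chomz_cons mulrDl ctD -IH //.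
  have -> : - m' - 1 = - (m' + 1) by rewrite opprD.
  set W := chomz _ (- (m' + 1)) in H *.
  have -> : D * W * y' = W * (D * y') by ring.
  rewrite -H -ctD; congr ct.
  rewrite zpowS !big_cons [(D, g).2]/= {1}eg; ring.
have freeDy y' : zfree i y' -> zfree i (D * y') by apply: zfreeM.
elim: n y hy => [|n IHn] y hy; apply: step => //.
  by rewrite chom_neg // mul0r pos //; exact: freeDy.
have -> : - n.+1%:Z + 1 = - n%:Z by lia.
exact/IHn/freeDy.
Qed.

End Novikov.
Arguments ct : simpl never.

(** * Elimination of one level *)

Section Elimination.
Variables (I : finType) (F : fieldType) (om : {additive expo I -> int}).
Local Notation N := (nser F om).
Local Notation mono := (@nmono I F om).
Local Notation io := (nC om).

Lemma ct_sum (J : Type) (r : seq J) (f : J -> N) :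
  ct (\sum_(j <- r) f j) = \sum_(j <- r) ct (f j).
Proof. by apply: (big_morph _ (@ctD _ _ _)). Qed.

Lemma ct_nC d (x : N) : ct (io d * x) = d * ct x.
Proof. by rewrite /ct /nC nval_mono subr0. Qed.

(** The variables are removed one at a time by [ct_elim1]; all have the same nodes [Ds], and the
    factors of one variable do not involve the others. *)
Lemma ct_elim (J : eqType) (r : seq J) (iv : J -> I) (Ds : seq N)
    (gs : J -> seq (N * N)) (m : J -> int) (y : N) :
  uniq r -> (forall j, j \in r -> [seq p.1 | p <- gs j] = Ds) ->
  (forall j x, j \in r -> x \in Ds -> zfree (iv j) x) ->
  (forall j p, j \in r -> p \in gs j ->
     nonneg (iv j) p.2 /\ p.2 = 1 + p.1 * zpow F om (iv j) 1 * p.2) ->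
  (forall i j p, i \in r -> j \in r -> i != j -> p \in gs j -> zfree (iv i) p.2) ->
  (forall i j, i \in r -> j \in r -> i != j -> iv i != iv j) ->
  (forall j, j \in r -> zfree (iv j) y) ->
  ct (\prod_(j <- r) (zpow F om (iv j) (m j) * \prod_(p <- gs j) p.2) * y)
  = ct (\prod_(j <- r) chomz Ds (- m j) * y).
Proof.
elim: r y => [|j r IH] y; first by rewrite !big_nil.
move=> /= /andP[jr ur] hD fD hg fg hiv hy.
have sub i : i \in r -> i \in j :: r by move=> ir; rewrite inE ir orbT.
rewrite !big_cons -!mulrA [zpow _ _ _ _ * _]mulrA.
rewrite ct_elim1; first last.
- apply: zfreeM; last exact/hy/mem_head.
  rewrite big_seq; apply: zfree_prod => i ir.
  have ij : j != i by apply: contraNneq jr => ->.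
  apply: zfreeM.
    by apply: supp_mono; rewrite evarM (negbTE (hiv _ _ (mem_head _ _) (sub _ ir) ij)).
  rewrite big_seq; apply: zfree_prod => p pg.
  exact: (fg _ _ _ (mem_head _ _) (sub _ ir) ij pg).
- move=> p pg; have [h1 h2] := hg _ _ (mem_head _ _) pg; split=> //.
  apply: fD (mem_head _ _) _; rewrite -(hD _ (mem_head _ _)).
  exact: (map_f (fun p => p.1) pg).
rewrite (hD j (mem_head j r)) [X in ct X = _]mulrCA [X in _ = ct X]mulrCA.
apply: IH => //.
- by move=> i ir; apply: hD; exact: sub.
- by move=> i x ir; apply: fD; exact: sub.
- by move=> i p ir; apply: hg; exact: sub.
- by move=> i i' p ir i'r; apply: fg; exact: sub.
- by move=> i i' ir i'r; apply: hiv; exact: sub.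
move=> i ir; apply: zfreeM; last exact/hy/sub.
apply: supp_chomz; [exact: zfree0 | exact: zfreeD |] => x xD.
exact: fD (sub _ ir) xD.
Qed.

(** The character embedding the monomials in the variables of one level into the series in all
    variables. *)
Definition lchi k (iv : 'I_k -> I) (u : expo 'I_k) : N :=
  mono 1 (\sum_j evar (iv j) *~ u j).

Lemma lchi0 k (iv : 'I_k -> I) : lchi iv 0 = 1.
Proof. by rewrite /lchi big1 // => j _; rewrite ffunE mulr0z. Qed.

Lemma lchiD k (iv : 'I_k -> I) u v : lchi iv (u + v) = lchi iv u * lchi iv v.
Proof.
rewrite /lchi -monoM mulr1 -big_split; congr mono.
by apply: eq_bigr => j _; rewrite ffunE mulrzDr.
Qed.

Lemma lchi_prod k (iv : 'I_k -> I) u : lchi iv u = \prod_j zpow F om (iv j) (u j).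
Proof.
rewrite /lchi /zpow; apply: (big_rec2 (fun x y => mono 1 x = y)) => // j x y _ <-.
by rewrite -monoM mulr1.
Qed.

(** A node 0 stands for the factor 1, so a next level with fewer variables can be completed by
    zeros. *)
Lemma nodeseq_pad (A : comNzRingType) (d q : A) x c k m : (m <= k)%N ->
  (forall j, (m <= j)%N -> x j = 0) -> forall z : int,
  chomz (nodeseq d q x k c) z = chomz (nodeseq d q x m c) z.
Proof.
move=> mk x0 z; have -> : nodeseq d q x k c = nodeseq d q x m c
    ++ [seq d * q ^+ l * x j | j <- iota m (k - m), l <- index_iota 0 c].
  have E : index_iota 0 k = index_iota 0 m ++ iota m (k - m).
    by rewrite /index_iota !subn0 -{1}(subnKC mk) iotaD.
  by rewrite /nodeseq E allpairs_cat.
rewrite chomz_cat0 //; apply/allP => _ /allpairsP[[j l] /= [+ _ ->]].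
by rewrite mem_iota => /andP[mj _]; rewrite x0 // mulr0.
Qed.

Lemma qpr_pad (A : comNzRingType) (q : A) x a k m : (m <= k)%N ->
  (forall j, (m <= j)%N -> x j = 0) ->
  \prod_(j < k) qpr q (x j) a = \prod_(j < m) qpr q (x j) a.
Proof.
move=> mk x0; rewrite -!(big_mkord xpredT (fun j => qpr q (x j) a)).
rewrite (big_cat_nat (n := m)) //= [X in _ * X]big_nat_cond [X in _ * X]big1 ?mulr1 //.
move=> j /andP[/andP[mj _] _]; rewrite x0 // /qpr big1 // => l _.
by rewrite mul0r subr0.
Qed.

(** The key identity inside the ring of series. [P] is expanded into its terms, [ct_elim] gives the
    constant term of each, and the total is the [fsum] evaluated by [fsum_eval]. *)
Lemma level_elim (q : F) (k m a a' b c : nat) (iv : 'I_k -> I) (w : 'I_m -> expo I)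
    (y : N) (e := b%:Z + 1 - c%:Z) :
  q != 0 -> (forall n r, q ^+ n = q ^+ r -> n = r) -> (0 < c)%N ->
  a'%:Z = a%:Z + e -> (m <= k)%N -> injective iv ->
  (forall i j, w j (iv i) = 0) ->
  (forall i j, 0 < wgt om (evar (iv i) - w j)) ->
  (forall i, zfree (iv i) y) ->
  ct (mval a b c (io q) (lchi iv)
      * (\prod_(j < m) \prod_(i < k) \prod_(l < c)
          ngeom om (q ^ e * q ^+ l) (evar (iv i) - w j)) * y)
  = ((- 1) ^ e * q ^ binomz2 (e + 1)) ^+ k * morris q k a' (c - 1) c
    * ct (\prod_(j < m) qpr (io q) (mono 1 (- w j)) a' * y).
Proof.
move=> q0 qI c0 ha mk ivI wiv wpos hy.
(* The inverses of the next variables, padded by 0 up to [k]. *)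
pose x (j : nat) : N := if insub j is Some i then mono 1 (- w i) else 0.
have xE (j : 'I_m) : x j = mono 1 (- w j) by rewrite /x valK.
have x0 j : (m <= j)%N -> x j = 0 by move=> mj; rewrite /x insubN // -leqNgt.
have Fe := fsum_eval io k x q0 qI c0 ha; rewrite -/e in Fe.
have -> : \prod_(j < m) qpr (io q) (mono 1 (- w j)) a' = \prod_(j < k) qpr (io q) (x j) a'.
  by rewrite (qpr_pad _ _ mk x0); apply: eq_bigr => j _; rewrite xE.
rewrite -ct_nC mulrA -Fe -(lpev_mlist a b c io q (lchi0 iv) (lchiD iv)).
rewrite /lpev /fsum !mulr_suml !ct_sum; apply: eq_bigr => z _.
rewrite -!mulrA !ct_nC; congr (_ * _).
rewrite (eq_bigr _ (fun i _ => nodeseq_pad (io (q ^ e)) (io q) c mk x0 (- z.2 i))).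
pose gs (i : 'I_k) : seq (N * N) :=
  [seq (io (q ^ e) * io q ^+ l * x j, ngeom om (q ^ e * q ^+ l) (evar (iv i) - w j))
    | j : 'I_m <- enum 'I_m, l <- index_iota 0 c].
have -> : \prod_i chomz (nodeseq (io (q ^ e)) (io q) x m c) (- z.2 i)
    = \prod_(i <- enum 'I_k) chomz (nodeseq (io (q ^ e)) (io q) x m c) (- z.2 i).
  by rewrite big_enum.
have -> : lchi iv z.2 * (\prod_(j < m) \prod_(i < k) \prod_(l < c)
      ngeom om (q ^ e * q ^+ l) (evar (iv i) - w j) * y)
    = \prod_(i <- enum 'I_k) (zpow F om (iv i) (z.2 i) * \prod_(p <- gs i) p.2) * y.
  rewrite mulrA; congr (_ * _); rewrite big_split big_enum big_enum -lchi_prod.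
  congr (_ * _); rewrite exchange_big; apply: eq_bigr => i _.
  by rewrite big_allpairs_dep big_enum; apply: eq_bigr => j _; rewrite big_mkord.
apply: ct_elim => //; first exact: enum_uniq.
- move=> i _; rewrite /gs map_allpairs /nodeseq [index_iota 0 m]/index_iota subn0 -val_enum_ord.
  by rewrite allpairs_mapl.
- move=> i _ _ /allpairsP[[j l] /= [+ _ ->]]; rewrite mem_index_iota /= => jm.
  rewrite -[j]/(val (Ordinal jm)) xE -rmorphXn -rmorphM /=.
  rewrite -mono_nC; apply: supp_mono.
  by rewrite ffunE wiv oppr0.
- move=> i _ _ /allpairsP[[j l] /= [_ _ ->]] /=; split.
    apply: supp_geom => // r; rewrite ffunMnE !ffunE wiv subr0 eqxx.
    by rewrite mulrn_wge0.
  rewrite xE {1}ngeomE //; congr (1 + _ * _).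
  by rewrite -rmorphXn -rmorphM -mono_nC /zpow -monoM mulr1 mulr1z addrC.
- move=> i i' _ _ _ ii' /allpairsP[[j l] /= [_ _ ->]] /=.
  apply: supp_geom => // r; rewrite ffunMnE !ffunE wiv subr0 (inj_eq ivI).
  by rewrite (negbTE ii') mul0rn.
- by move=> i i' _ _ ii'; rewrite (inj_eq ivI).
Qed.

End Elimination.

(** * The iterated constant term *)

(* Negated level number: every ratio [z^(s)_i / z^(s+1)_j] has weight 1. *)
Definition lweight (n : nat) (k : 'I_n -> nat) (u : expo (zvar k)) : int :=
  - \sum_(x : zvar k) (tag x : nat)%:Z * u x.

Lemma lweight_is_additive n (k : 'I_n -> nat) : zmod_morphism (@lweight n k).
Proof.
move=> u v; rewrite /lweight -opprD -sumrB; congr (- _).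
by apply: eq_bigr => x _; rewrite !ffunE mulrBr.
Qed.
HB.instance Definition _ n k := GRing.isZmodMorphism.Build (expo (zvar k)) int
  (@lweight n k) (@lweight_is_additive n k).

Lemma lweight_evar n (k : 'I_n -> nat) (x : zvar k) : lweight (evar x) = - (tag x : nat)%:Z.
Proof.
rewrite /lweight (bigD1 x) //= ffunE eqxx mulr1 big1 ?addr0 // => y yx.
by rewrite ffunE (negbTE yx) mulr0.
Qed.

Section Levels.
Variables (F : fieldType) (q : F).
Hypothesis q0 : q != 0.
Hypothesis qI : forall m r, q ^+ m = q ^+ r -> m = r.
Variables (n c a : nat) (k b : 'I_n -> nat).
Hypothesis c0 : (0 < c)%N.
Hypothesis hk : forall s t : 'I_n, (s <= t)%N -> (k t <= k s)%N.
Hypothesis hab : forall s : 'I_n, (s.+1 * c <= a + sigma b s + s.+1)%N.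

Local Notation om := (@lweight n k : {additive expo (zvar k) -> int}).
Local Notation N := (nser F om).
Local Notation mono := (@nmono _ F om).
Local Notation io := (@nC _ F om).
Let e (s : 'I_n) : int := (b s)%:Z + 1 - c%:Z.
Let iv (s : 'I_n) (i : 'I_(k s)) : zvar k := Tagged (fun t => 'I_(k t)) i.

Lemma wgt_ratio (s t : 'I_n) (i : 'I_(k s)) (j : 'I_(k t)) : (t : nat) = s.+1 ->
  0 < wgt om (zexp i - zexp j).
Proof.
move=> ts; rewrite wgtB /wgt /= -[zexp i]/(evar (iv i)) -[zexp j]/(evar (iv j)).
by rewrite !lweight_evar /= ts; lia.
Qed.

Lemma nval_qpoch d u m : nval (qpr (io q) (io d * mono 1 u) m) = lqpoch q d u m.
Proof.
rewrite nval_prod; apply: eq_bigr => l _; rewrite -(nval_factor om); congr (nval (1 - _)).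
by rewrite mulrAC -rmorphXn -rmorphM -mono_nC.
Qed.

Lemma nval_qpoch1 u m : nval (qpr (io q) (mono 1 u) m) = lqpoch q 1 u m.
Proof. by rewrite -nval_qpoch rmorph1 mul1r. Qed.

Lemma nval_qpochV d u m : 0 < wgt om u ->
  nval (\prod_(l < m) ngeom om (d * q ^+ l) u) = lqpochV q d u m.
Proof. by move=> u0; rewrite nval_prod; apply: eq_bigr => l _; rewrite nval_geom. Qed.

Definition next_den (s : 'I_n) : N :=
  \prod_(t < n | (t : nat) == s.+1) \prod_(j < k t) \prod_(i < k s) \prod_(l < c)
    ngeom om (q ^ (e s) * q ^+ l) (zexp i - zexp j).

(** The parameter [a'] is left free, as eliminating the previous level changes it. *)
Definition level (a' : nat) (s : 'I_n) : N :=
  mval a' (b s) c (io q) (lchi F om (@iv s)) * next_den s.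

Lemma lchi_evar (s : 'I_n) (i : 'I_(k s)) (m : int) :
  lchi F om (@iv s) (evar i *~ m) = mono 1 (zexp i *~ m).
Proof.
rewrite /lchi (bigD1 i) //= evarM eqxx big1 ?addr0 // => j ji.
by rewrite evarM (negbTE ji) mulr0z.
Qed.

Lemma nval_level (s : 'I_n) :
  nval (level (alevel a s) s) = lmul (level_num q c a b s) (level_denV q c b s).
Proof.
pose num : N := (\prod_(i < k s) (qpr (io q) (mono 1 (- zexp i)) (alevel a s)
      * qpr (io q) (io q * mono 1 (zexp i)) (b s)))
  * \prod_(i < k s) \prod_(j < k s | (i < j)%N)
     (qpr (io q) (mono 1 (zexp i - zexp j)) c
      * qpr (io q) (io q * mono 1 (zexp j - zexp i)) c).
pose den : N := (\prod_(i < k s) mono 1 (zexp i *~ (- e s))) * next_den s.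
have c1 (i : 'I_(k s)) : lchi F om (@iv s) (evar i) = mono 1 (zexp i).
  by rewrite -[evar i]mulr1z lchi_evar.
have cN (i : 'I_(k s)) : lchi F om (@iv s) (- evar i) = mono 1 (- zexp i).
  by rewrite -[evar i]mulr1z -mulrNz lchi_evar mulrNz.
have -> : level (alevel a s) s = num * den.
  rewrite /level /mval /num /den.
  rewrite (eq_bigr (fun i => qpr (io q) (mono 1 (- zexp i)) (alevel a s)
      * qpr (io q) (io q * mono 1 (zexp i)) (b s) * mono 1 (zexp i *~ (- e s)))); last first.
    by move=> i _; rewrite c1 cN lchi_evar.
  rewrite big_split [X in _ * X * _](_ : _ = \prod_(i < k s) \prod_(j < k s | (i < j)%N)
     (qpr (io q) (mono 1 (zexp i - zexp j)) c
      * qpr (io q) (io q * mono 1 (zexp j - zexp i)) c)).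
    by rewrite -!mulrA; congr (_ * _); rewrite mulrCA.
  apply: eq_bigr => i _; apply: eq_bigr => j _.
  by rewrite !lchiD !c1 !cN -!monoM mulr1.
rewrite nvalM; congr lmul.
  rewrite nvalM !nval_prod; congr lmul; apply: eq_bigr => i _.
    by rewrite nvalM nval_qpoch1 nval_qpoch.
  by rewrite nval_prod; apply: eq_bigr => j _; rewrite nvalM nval_qpoch1 nval_qpoch.
rewrite nvalM !nval_prod; congr lmul; apply: eq_bigr => t /eqP ts.
rewrite nval_prod; apply: eq_bigr => j _; rewrite nval_prod; apply: eq_bigr => i _.
by rewrite nval_qpochV // wgt_ratio.
Qed.

Lemma nval_integrand :
  nval (\prod_(s < n) level (alevel a s) s) = integrand (k := k) q c a b.
Proof. by rewrite nval_prod; apply: eq_bigr => s _; exact: nval_level. Qed.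

Lemma mval_split (A : comNzRingType) (p : A) r a' b' (chi : expo 'I_r -> A) :
  mval a' b' c p chi = mval 0 b' c p chi * \prod_i qpr p (chi (- evar i)) a'.
Proof.
rewrite /mval [RHS]mulrAC; congr (_ * _); rewrite -big_split; apply: eq_bigr => i _ /=.
by rewrite [qpr _ _ 0]/qpr big_ord0 mul1r; ring.
Qed.

(** The product over [t] makes this 1 when [m = n], past the last level. *)
Definition front (a' : nat) (m : nat) : N :=
  \prod_(t < n | (t : nat) == m) \prod_(j < k t) qpr (io q) (mono 1 (- zexp j)) a'.

Lemma front_ord a' (s : 'I_n) :
  front a' s = \prod_(j < k s) qpr (io q) (mono 1 (- zexp j)) a'.
Proof. by rewrite /front (big_pred1 s). Qed.

Lemma level_front a' s : level a' s = level 0 s * front a' s.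
Proof.
rewrite /level mval_split mulrAC front_ord; congr (_ * _ * _); apply: eq_bigr => i _.
by rewrite -[evar i]mulr1z -mulrNz lchi_evar mulrNz.
Qed.

(* The parameter [a] at level [m] once the lower levels have been eliminated. *)
Definition apar (m : nat) : nat := (a + \sum_(r < n | (r < m)%N) b r + m - m * c)%N.

Lemma apar0 : apar 0 = a.
Proof. by rewrite /apar big_pred0 // mul0n subn0 !addn0. Qed.

Lemma aparS (s : 'I_n) : apar s.+1 = (a + sigma b s + s.+1 - s.+1 * c)%N.
Proof. by []. Qed.

(** By the hypothesis [hab] at [s] and at the level before, both truncated subtractions are
    exact. *)
Lemma apar_step (s : 'I_n) : (apar s.+1)%:Z = (apar s)%:Z + e s.
Proof.
have h1 : (s.+1 * c <= a + sigma b s + s.+1)%N := hab s.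
have h2 : (s * c <= a + \sum_(r < n | (r < s)%N) b r + s)%N.
  case: (nat_of_ord s) (ltn_ord s) => [|m] mn; first by rewrite mul0n.
  exact: (hab (Ordinal (ltnW mn))).
have h3 : sigma b s = (b s + \sum_(r < n | (r < s)%N) b r)%N.
  rewrite /sigma (bigD1 s) //=; congr (_ + _)%N; apply: eq_bigl => r.
  by rewrite -val_eqE /=; lia.
rewrite aparS /apar -!subzn // h3 /e mulSn !PoszD; ring.
Qed.

Lemma supp_opp (P : expo (zvar k) -> Prop) (x : N) : supp P x -> supp P (- x).
Proof. by move=> h u; rewrite /= oppr_eq0; apply: h. Qed.

Lemma zfree_qpr (x : zvar k) (y : N) m : zfree x y -> zfree x (qpr (io q) y m).
Proof.
move=> hy; apply: zfree_prod => l _.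
apply: supp_add; first by apply: supp_one; exact: zfree0.
apply: supp_opp; apply: zfreeM => //.
by rewrite -rmorphXn; apply: supp_mono; exact: zfree0.
Qed.

(** Level [s] involves only the variables of level [s] and of the next one. *)
Lemma zfree_level (x : zvar k) (s : 'I_n) : (tag x < s)%N -> zfree x (level 0 s).
Proof.
move=> xs.
have zx (t : 'I_n) (i : 'I_(k t)) : (s <= t)%N -> zexp i x = 0.
  move=> st; rewrite ffunE; case: eqP => // xi; move: xs; rewrite xi /=; lia.
have chi u : zfree x (lchi F om (@iv s) u).
  apply: supp_mono; rewrite sum_ffunE big1 // => j _.
  by rewrite ffunMzE -[evar _]/(zexp j) zx // mul0rz.
have qchi u : zfree x (io q * lchi F om (@iv s) u).
  by apply: zfreeM => //; apply: supp_mono; exact: zfree0.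
apply: zfreeM; first apply: zfreeM.
- apply: zfree_prod => i _; apply: zfreeM; first apply: zfreeM; first exact: zfree_qpr.
    exact: zfree_qpr.
  exact: chi.
- apply: zfree_prod => i _; apply: zfree_prod => j _; apply: zfreeM; exact: zfree_qpr.
apply: zfree_prod => t /eqP ts; apply: zfree_prod => j _; apply: zfree_prod => i _; apply: zfree_prod => l _.
apply: supp_geom; last exact: wgt_ratio.
move=> m; have -> : ((zexp i - zexp j) *+ m) x = (zexp i x - zexp j x) *+ m.
  by rewrite ffunMnE !ffunE.
by rewrite !zx ?ts // subrr mul0rn.
Qed.

(** What is left of the integrand, up to a constant, once the levels below [m] are eliminated. *)
Definition remaining (m : nat) : N :=
  front (apar m) m * \prod_(r < n | (m <= r)%N) level 0 r.

Lemma remaining0 : \prod_(s < n) level (alevel a s) s = remaining 0.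
Proof.
rewrite /remaining apar0 mulrC; under eq_bigr do rewrite level_front.
rewrite big_split; congr (_ * _); rewrite [RHS]/front [RHS]big_mkcond.
apply: eq_bigr => s _; rewrite front_ord /alevel; case: eqP => // _.
by rewrite big1 // => j _; rewrite /qpr big_ord0.
Qed.

Lemma remaining_last : remaining n = 1.
Proof.
rewrite /remaining /front big_pred0 => [|t]; last by rewrite ltn_eqF.
by rewrite mul1r big_pred0 // => t; rewrite leqNgt ltn_ord.
Qed.

Definition level_const (s : 'I_n) : F :=
  ((- 1) ^ e s * q ^ binomz2 (e s + 1)) ^+ k s * morris q (k s) (apar s.+1) (c - 1) c.

(** [level_elim] applies to level [s], the later levels being free of its variables, and leaves the
    [front] of the next level with the new parameter. *)
Lemma remaining_step (s : 'I_n) : ct (remaining s) = level_const s * ct (remaining s.+1).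
Proof.
rewrite /remaining [X in _ * X](bigD1 s) //= mulrA [front _ _ * _]mulrC -level_front.
rewrite (eq_bigl (fun r : 'I_n => (s < r)%N)); last by move=> r; rewrite -val_eqE /=; lia.
set y := \prod_(r < n | _) _.
have hy (i : 'I_(k s)) : zfree (iv i) y by apply: zfree_prod => r sr; exact: zfree_level.
have ivI : injective (@iv s) by move=> i j /eqP; rewrite eq_Tagged => /eqP.
have elim m (w : 'I_m -> expo (zvar k)) mk (wiv : forall i j, w j (iv i) = 0)
    (wpos : forall i j, 0 < wgt om (evar (iv i) - w j)) :=
  level_elim q0 qI c0 (apar_step s) mk ivI wiv wpos hy.
rewrite /level /next_den; have [sn|ns] := ltnP s.+1 n.
  pose t := Ordinal sn; rewrite -[s.+1]/(t : nat) front_ord !(big_pred1 t) //.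
  apply: elim => [|i j|i j]; first by apply: hk; exact: leqnSn.
    rewrite ffunE; case: eqP => // /(congr1 (fun x : zvar k => nat_of_ord (tag x))) /= st.
    by have := ltnSn s; rewrite {1}st ltnn.
  exact: wgt_ratio.
(* At the last level the denominator is empty, and [level_elim] is used with no next variables. *)
rewrite big_pred0 => [|t]; last by rewrite ltn_eqF // (leq_trans (ltn_ord t)).
rewrite /front big_pred0 => [|t]; last by rewrite ltn_eqF // (leq_trans (ltn_ord t)).
have := elim 0%N (fun=> 0) isT; rewrite !big_ord0 => E.
by apply: E => i [].
Qed.

Lemma ct_integrand : ct (\prod_(s < n) level (alevel a s) s) = \prod_(s < n) level_const s.
Proof.
rewrite remaining0; have H m : (m <= n)%N ->
    ct (remaining 0) = (\prod_(s < n | (s < m)%N) level_const s) * ct (remaining m).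
  elim: m => [|m IH] mn; first by rewrite big_pred0 // mul1r.
  rewrite IH 1?ltnW // (remaining_step (Ordinal mn)) mulrA; congr (_ * _).
  rewrite [RHS](bigD1 (Ordinal mn)) //= mulrC; congr (_ * _); apply: eq_bigl => s.
  by rewrite -val_eqE /=; lia.
rewrite (H n) // remaining_last (eq_bigl xpredT) => [|s]; last exact: ltn_ord.
by rewrite /ct nval1 /lone /lmonom eqxx mulr1.
Qed.

Lemma prod_exprz (x : F) (f : 'I_n -> int) : x != 0 ->
  x ^ (\sum_(s < n) f s) = \prod_(s < n) x ^ f s.
Proof. by move=> x0; apply: (big_morph (fun m => x ^ m)) => // i j; rewrite expfzDr. Qed.

Lemma prod_level_const : \prod_(s < n) level_const s =
  (- 1) ^ (\sum_(s < n) (k s)%:Z * ((b s)%:Z + 1 - c%:Z))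
  * q ^ (\sum_(s < n) (k s)%:Z * binomz2 ((b s)%:Z + 2 - c%:Z))
  * \prod_(s < n) morris q (k s) (a + sigma b s + s.+1 - s.+1 * c) (c - 1) c.
Proof.
rewrite !prod_exprz ?oppr_eq0 ?oner_eq0 // -!big_split; apply: eq_bigr => s _ /=.
rewrite /level_const aparS exprMn; congr (_ * _ * _).
  by rewrite exprnP exprz_exp mulrC.
by rewrite exprnP exprz_exp mulrC; congr (_ ^ (_ * binomz2 _)); rewrite /e; lia.
Qed.

Lemma lCT_integrand : lCT (integrand (k := k) q c a b) = \prod_(s < n) level_const s.
Proof. by rewrite -ct_integrand /ct nval_integrand. Qed.

End Levels.

(** * The indeterminate [q] over the rationals *)

Lemma qq_neq0 : qq != 0.
Proof. by rewrite tofrac_eq0 polyX_eq0. Qed.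

Lemma qq_inj m r : qq ^+ m = qq ^+ r -> m = r.
Proof.
rewrite /qq -!tofracXn => /eqP; rewrite tofrac_eq => /eqP /(congr1 (fun p : {poly rat} => size p)).
by rewrite !size_polyXn => -[].
Qed.

Theorem theorem1p2 (n c a : nat) (k b : 'I_n -> nat)
    (hn : (0 < n)%N) (hc : (0 < c)%N)
    (hk : forall s t : 'I_n, (s <= t)%N -> (k t <= k s)%N)
    (hab : forall s : 'I_n, (s.+1 * c <= a + sigma b s + s.+1)%N) :
  lCT (integrand (k := k) qq c a b) =
    (-1) ^ (\sum_(s < n) (k s)%:Z * ((b s)%:Z + 1 - c%:Z))
    * qq ^ (\sum_(s < n) (k s)%:Z * binomz2 ((b s)%:Z + 2 - c%:Z))
    * \prod_(s < n)
        morris qq (k s) (a + sigma b s + s.+1 - s.+1 * c) (c - 1) c.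
Proof.
rewrite (lCT_integrand qq_neq0 qq_inj hc hk hab).
exact: (prod_level_const qq_neq0).
Qed.
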